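(* For all integers $1\le r\le s\le t$, $$\delta_{\mathrm{VC}}(K_{r,s,t})=\begin{cases}\frac13, & r=s=1,\\[1mm] \frac{s}{2s+1}, & r=1,\ s\ge 2,\ t\ge 2s-2,\\[1mm] \frac12, & \text{otherwise.}\end{cases}$$
   Context: All graphs are finite and simple. $K_{r,s,t}$ is the complete tripartite graph with parts of sizes $r,s,t$. A graph is $H$-free if it contains no (not necessarily induced) subgraph isomorphic to $H$; it is maximal $H$-free if it is $H$-free and adding any missing edge creates a copy of $H$. $\delta(G)$ denotes minimum degree. The VC-dimension $\mathrm{VC}(G)$ of a graph $G$ is the VC-dimension of the set system $\{N_G(v):v\in V(G)\}$ on $V(G)$, i.e. the maximum size of a set $S\subseteq V(G)$ such that $\{N_G(v)\cap S: v\in V(G)\}=2^S$. The VC-dimension threshold $\delta_{\mathrm{VC}}(H)$ is the infimum of all $\gamma\ge 0$ for which there exists a constant $C=C(\gamma,H)$ such that every maximal $H$-free graph $G$ with $\delta(G)\ge\gamma|V(G)|$ satisfies $\mathrm{VC}(G)\le C$. *)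

(* Defs.v *)
From mathcomp Require Import all_boot all_order all_algebra.
From mathcomp Require Import classical_sets reals.
Set Implicit Arguments.
Unset Strict Implicit.
Unset Printing Implicit Defensive.
Import Order.TTheory GRing.Theory Num.Theory.

(* A finite simple graph is given by its vertex type [T : finType] and its
   adjacency relation [e : rel T]. *)
Definition simple_graph (T : finType) (e : rel T) : Prop :=
  symmetric e /\ irreflexive e.

Definition neighbors (T : finType) (e : rel T) (v : T) : {set T} :=
  [set w : T | e v w]%SET.

Definition degree (T : finType) (e : rel T) (v : T) : nat :=
  #|neighbors e v|.

(* The default [#|T|] exceeds every degree of a simple graph, so it only
   matters for the graph without vertices, where the value is 0. *)
Definition min_degree (T : finType) (e : rel T) : nat :=
  \big[Order.min/#|T|]_(v : T) degree e v.

(* Not necessarily induced. *)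
Definition contains_copy (U : finType) (h : rel U) (T : finType) (e : rel T)
    : Prop :=
  exists f : U -> T, injective f /\ forall x y : U, h x y -> e (f x) (f y).

Definition graph_free (U : finType) (h : rel U) (T : finType) (e : rel T)
    : Prop :=
  ~ contains_copy h e.

Definition add_edge (T : finType) (e : rel T) (u v : T) : rel T :=
  [rel x y | [|| e x y, (x == u) && (y == v) | (x == v) && (y == u)]].

Definition maximal_free (U : finType) (h : rel U) (T : finType) (e : rel T)
    : Prop :=
  graph_free h e /\
  forall u v : T, u != v -> ~~ e u v -> contains_copy h (add_edge e u v).

Definition shattered (T : finType) (e : rel T) (S : {set T}) : bool :=
  [forall A in powerset S, exists v : T, neighbors e v :&: S == A].

Definition VC_dim (T : finType) (e : rel T) : nat :=
  \max_(S : {set T} | shattered e S) #|S|.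

Definition VC_admissible (R : realType) (U : finType) (h : rel U) (g : R)
    : Prop :=
  exists C : nat, forall (T : finType) (e : rel T),
    simple_graph e -> maximal_free h e ->
    (g * #|T|%:R <= (min_degree e)%:R)%R -> (VC_dim e <= C)%N.

(* [inf] is the genuine infimum here: the set is bounded below by 0, and it
   contains 1 because a graph with a vertex has minimum degree less than its
   number of vertices. *)
Definition VC_threshold (R : realType) (U : finType) (h : rel U) : R :=
  inf [set g : R | (0 <= g)%R /\ VC_admissible h g]%classic.

Definition tripartite_part (r s t : nat) (x : 'I_r + 'I_s + 'I_t) : 'I_3 :=
  match x with
  | inl (inl _) => inord 0
  | inl (inr _) => inord 1
  | inr _ => inord 2
  end.

Definition complete_tripartite (r s t : nat) : rel ('I_r + 'I_s + 'I_t)%type :=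
  [rel x y | tripartite_part x != tripartite_part y].
Arguments complete_tripartite : clear implicits.

(* Main.v *)
Require Import Defs.
From mathcomp Require Import all_boot all_order all_algebra.
From mathcomp Require Import boolp classical_sets reals.
From mathcomp Require Import zify lra.
From mathcomp Require Import fintype finset.
Set Implicit Arguments.
Unset Strict Implicit.
Unset Printing Implicit Defensive.
Import Order.TTheory GRing.Theory Num.Theory.

(* Write [delta] for the minimum degree and [n] for the number of vertices.

   Upper bounds. For [delta >= (1/2 + eps) n] pigeonholing traces yields a large
   [K_{q,q}], then a [K_{s,s,t}], so [n] is bounded. For [K_{1,1,t}] and
   [delta >= (1/3 + eps) n], adjacent vertices have fewer than [t] common
   neighbors, while nonadjacent ones have a common neighbor by maximality, hence
   linearly many by inclusion-exclusion; a shattered set with such a gap is small.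
   For [K_{1,s,t}] with [t >= 2s - 2] and [delta >= (s/(2s+1) + eps) n], call two
   vertices far if they have few common neighbors. Since [delta > 2n/5] there is
   no closed 5-walk of far pairs, and each vertex has boundedly many neighbors
   that are not far; hence being close is an equivalence relation with two
   classes. Any [s + 1] vertices of a class have many common neighbors, so degrees
   within a class are below [s], and [t >= 2s - 2] with maximality makes the pair
   of classes complete.

   Lower bounds. On top of a large bipartite graph one plants vertices [x_i] and
   [v_A], [A] a set of indices, with [x_i] adjacent to [v_A] when [i \in A], and
   such that every other edge [x_i v_A] would create a copy; any maximal extension
   then still shatters the [x_i]. *)

(** * Preliminaries *)

Lemma min_degree_le (T : finType) (e : rel T) (v : T) :
  min_degree e <= degree e v.
Proof. by rewrite -leEnat; apply: bigmin_le. Qed.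

Lemma le_min_degree (T : finType) (e : rel T) (D : nat) :
  D <= #|T| -> (forall v, D <= degree e v) -> D <= min_degree e.
Proof.
by rewrite -!leEnat => DT De; apply: le_bigmin => // v _; rewrite leEnat; apply: De.
Qed.

Lemma shatteredP (T : finType) (e : rel T) (S : {set T}) :
  reflect (forall A : {set T}, A \subset S ->
             exists v, neighbors e v :&: S = A)
          (shattered e S).
Proof.
apply: (iffP forall_inP) => shS A AS.
  have /existsP[v /eqP] : [exists v, neighbors e v :&: S == A];
    [by apply: shS; rewrite powersetE | by exists v].
have [v vA] : exists v, neighbors e v :&: S = A by apply: shS; rewrite powersetE in AS.
by apply/existsP; exists v; apply/eqP.
Qed.

Lemma shattered_sub (T : finType) (e : rel T) (S S' : {set T}) :
  S' \subset S -> shattered e S -> shattered e S'.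
Proof.
move=> S'S /shatteredP shS; apply/shatteredP => A AS'.
have [v vA] := shS A (subset_trans AS' S'S).
by exists v; rewrite -(setIidPr S'S) setIA vA; apply/setIidPl.
Qed.

Lemma subset_of_card (T : finType) (S : {set T}) (k : nat) :
  k <= #|S| -> exists2 S' : {set T}, S' \subset S & #|S'| = k.
Proof.
move=> kS; exists [set x in take k (enum S)].
  by apply/subsetP => x; rewrite inE => /mem_take; rewrite mem_enum.
by rewrite cardsE (card_uniqP _) ?take_uniq ?enum_uniq // size_takel // -cardE.
Qed.

Lemma VC_dim_le (T : finType) (e : rel T) (C : nat) :
  (forall S : {set T}, shattered e S -> #|S| = C.+1 -> False) ->
  VC_dim e <= C.
Proof.
move=> noS; apply/bigmax_leqP => S shS; rewrite leqNgt; apply/negP => CS.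
have [S' S'S cS'] := subset_of_card CS.
exact: noS (shattered_sub S'S shS) cS'.
Qed.

Lemma VC_dim_le_card (T : finType) (e : rel T) : VC_dim e <= #|T|.
Proof. by apply/bigmax_leqP => S _; apply: max_card. Qed.

(** Disjointness of the three sets comes from [irr]: vertices of different parts have adjacent,
    hence distinct, images, and inside one part [enum_val] is injective. *)
Lemma complete_tripartite_copy (T : finType) (e : rel T) (r s t : nat)
    (A B C : {set T}) :
  symmetric e -> irreflexive e ->
  r <= #|A| -> s <= #|B| -> t <= #|C| ->
  {in A & B, forall x y, e x y} -> {in A & C, forall x y, e x y} ->
  {in B & C, forall x y, e x y} ->
  contains_copy (complete_tripartite r s t) e.
Proof.
move=> sym irr rA sB tC AB AC BC.
have inA (i : 'I_r) : enum_val (widen_ord rA i) \in A by apply: enum_valP.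
have inB (i : 'I_s) : enum_val (widen_ord sB i) \in B by apply: enum_valP.
have inC (i : 'I_t) : enum_val (widen_ord tC i) \in C by apply: enum_valP.
pose f (x : 'I_r + 'I_s + 'I_t) := match x with
  | inl (inl i) => enum_val (widen_ord rA i)
  | inl (inr i) => enum_val (widen_ord sB i)
  | inr i => enum_val (widen_ord tC i) end.
have fe x y : complete_tripartite r s t x y -> e (f x) (f y).
  case: x => [[]|] i; case: y => [[]|] j; rewrite /complete_tripartite /= ?eqxx //= => _;
    first [exact: AB | exact: AC | exact: BC
         | by rewrite sym; first [exact: AB | exact: AC | exact: BC]].
exists f; split=> // x y fxy.
have : ~~ complete_tripartite r s t x y.
  by apply/negP => /fe; rewrite fxy irr.
have ord3 (a b : nat) : a < 3 -> b < 3 -> inord a == inord b :> 'I_3 = (a == b).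
  by move=> a3 b3; rewrite -val_eqE /= !inordK.
case: x fxy => [[]|] i; case: y => [[]|] j; rewrite /complete_tripartite /= ?ord3 //= => + _;
  by move=> /enum_val_inj /(congr1 val) /= /val_inj ->.
Qed.

(* Points seeing more than [k] members of [Q] carry the excess over [k * #|W|];
   many of them then have the same trace on [Q]. *)
Lemma trace_pigeonhole (T : finType) (e : rel T) (Q W : {set T}) (k t : nat) :
  symmetric e ->
  k * #|W| + #|Q| * (2 ^ #|Q| * t) < \sum_(q in Q) #|neighbors e q :&: W| ->
  exists B Z : {set T}, [/\ B \subset Q, k < #|B|, Z \subset W, t < #|Z| &
    {in B & Z, forall x y, e x y}].
Proof.
move=> sym big.
pose tr w := neighbors e w :&: Q.
pose W' := [set w in W | k < #|tr w|].
have sumE : \sum_(q in Q) #|neighbors e q :&: W| = \sum_(w in W) #|tr w|.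
  rewrite (eq_bigr (fun q => \sum_(w in W) (e q w : nat))); last first.
    move=> q _; rewrite -sum1_card big_mkcond [RHS]big_mkcond /=.
    by apply: eq_bigr => w _; rewrite !inE; do 2!case: ifP => //=; case: (e q w) => //; rewrite ?andbF.
  rewrite exchange_big; apply: eq_bigr => w _.
  rewrite -sum1_card big_mkcond [RHS]big_mkcond /=.
  by apply: eq_bigr => q _; rewrite !inE sym; case: (q \in Q) => //; case: (e w q).
have ub : \sum_(w in W) #|tr w| <= k * #|W| + #|Q| * #|W'|.
  have -> : #|W'| = \sum_(w in W) (k < #|tr w|).
    rewrite -sum1_card big_mkcond [RHS]big_mkcond /=.
    by apply: eq_bigr => w _; rewrite !inE; case: (w \in W) => //; case: ltnP.
  rewrite mulnC -sum_nat_const big_distrr -big_split /=; apply: leq_sum => w _.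
  case: ltnP => /= h; last by rewrite muln0 addn0.
  by rewrite muln1 (leq_trans _ (leq_addl _ _)) // subset_leq_card // subsetIr.
have W'big : 2 ^ #|Q| * t < #|W'|.
  have : #|Q| * (2 ^ #|Q| * t) < #|Q| * #|W'|.
    by rewrite -(ltn_add2l (k * #|W|)) (leq_trans big) // sumE.
  by rewrite ltn_mul2l => /andP[].
have [B BQ tB] : exists2 B, B \in powerset Q & t < #|[set w in W' | tr w == B]|.
  apply/exists_inP; apply: contraT; rewrite negb_exists_in => /forall_inP small.
  suff : #|W'| <= 2 ^ #|Q| * t by rewrite leqNgt W'big.
  rewrite -card_powerset -sum_nat_const -sum1_card.
  rewrite (partition_big tr (mem (powerset Q))) /=; last first.
    by move=> w _; rewrite powersetE subsetIr.
  apply: leq_sum => B BQ; rewrite sum1_card.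
  have := small B BQ; rewrite -leqNgt; apply: leq_trans.
  by apply: subset_leq_card; apply/subsetP => w; rewrite unfold_in [in X in _ -> X]inE.
exists B, [set w in W' | tr w == B]; split => //.
- by rewrite -powersetE.
- have [w] : exists w, w \in [set w in W' | tr w == B].
    by apply/card_gt0P; apply: leq_trans tB.
  by rewrite !inE => /andP[/andP[_ kw] /eqP <-].
- by apply/subsetP => w; rewrite !inE => /andP[/andP[]].
- by move=> x w xB; rewrite !inE => /andP[_ /eqP trw]; move: xB; rewrite -trw !inE sym => /andP[].
Qed.

(** * Dense graphs and gaps between codegrees *)

(** Turns the real slack into an integer one: if [1 < K * (g * q - p)], then
    [D >= (p / q + 1 / (q * K)) * n]. The upper bounds can then be proved in [nat]. *)
Lemma gt_ratio (R : realType) (g : R) (p q : nat) :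
  0 < q -> (p%:R / q%:R < g)%R ->
  exists2 K, 0 < K & forall n D : nat, (g * n%:R <= D%:R)%R ->
    (p * K + 1) * n <= q * K * D.
Proof.
move=> q0 pg.
have q0R : (0 < q%:R :> R)%R by rewrite ltr0n.
have gap : (0 < g * q%:R - p%:R)%R by rewrite subr_gt0 -ltr_pdivrMr.
have [K0 Kgap] : exists K : nat, (1 < K%:R * (g * q%:R - p%:R))%R.
  exists (Num.bound ((g * q%:R - p%:R)^-1)%R).
  by rewrite -ltr_pdivrMr // mul1r archi_boundP // invr_ge0 ltW.
exists K0 => [|n D gD].
  by case: K0 Kgap => // /[!mul0r]; rewrite ltr10.
rewrite -(ler_nat R) !natrM natrD natrM.
apply: (@le_trans _ _ (q%:R * K0%:R * (g * n%:R))%R); last first.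
  by apply: ler_wpM2l => //; rewrite mulr_ge0.
rewrite mulrA ler_wpM2r //; nra.
Qed.

Lemma sum_lower (T : finType) (Q : {set T}) (F : T -> nat) (m a : nat) :
  {in Q, forall x, m <= a * F x} -> #|Q| * m <= a * \sum_(x in Q) F x.
Proof. by move=> mF; rewrite -sum_nat_const big_distrr leq_sum. Qed.

(** Two rounds of [trace_pigeonhole]: the first, on any [2 * q] vertices, gives a [K_{q,q}]; the
    second, on the vertex set of that [K_{q,q}], gives many vertices joined to the same [q + s] of
    its vertices. *)
Lemma dense_contains_tripartite (K r s t : nat) : 0 < K -> 0 < s -> r <= s ->
  exists N0, forall (T : finType) (e : rel T), symmetric e -> irreflexive e ->
    (forall v, (K + 1) * #|T| <= 2 * K * degree e v) -> N0 <= #|T| ->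
    contains_copy (complete_tripartite r s t) e.
Proof.
(* With [q = s * K], the degrees of [2 * q] vertices sum to at least [(q + s) * #|T|], so a vertex
   sees [q + s] of them on average. *)
move=> K0 s0 rs; pose q := s * K; pose c := 2 * q * (2 ^ (2 * q) * (q + t)).
exists (c + 2 * q + 1) => T e sym irr deg nT.
have q0 : 0 < q by rewrite muln_gt0 s0.
have step (Q : {set T}) (k u : nat) : #|Q| = 2 * q -> u <= q + t ->
    k.+1 <= q + s ->
    exists B Z : {set T}, [/\ B \subset Q, k < #|B|, Z \subset setT, u < #|Z| &
      {in B & Z, forall x y, e x y}].
  move=> cQ ut kq; apply: trace_pigeonhole => //.
  have := @sum_lower _ Q (fun x => #|neighbors e x :&: setT|) ((K + 1) * #|T|) (2 * K) _.
  rewrite cQ cardsT => /(_ _)/wrap[x _|]; first by rewrite setIT; apply: deg.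
  set S := (\sum_(_ in _) _) => lbS.
  have {}lbS : (q + s) * #|T| <= S by rewrite /q in lbS *; nia.
  have : 2 * q * (2 ^ (2 * q) * u) <= c by rewrite /c !leq_mul2l ut !orbT.
  nia.
have [Q0 _ cQ0] := @subset_of_card T setT (2 * q) ltac:(rewrite cardsT; lia).
have [B [Z [_ kB _ tZ BZ]]] := step Q0 q.-1 q cQ0 ltac:(lia) ltac:(lia).
have [B' B'B cB'] := @subset_of_card T B q ltac:(lia).
have [Z' Z'Z cZ'] := @subset_of_card T Z q ltac:(lia).
have B'Z' : {in B' & Z', forall x y, e x y}.
  by move=> x y xB yZ; apply: BZ; [apply: (subsetP B'B) | apply: (subsetP Z'Z)].
have dis : [disjoint B' & Z'].
  rewrite -setI_eq0; apply/eqP/setP => x; rewrite !inE; apply/negP => /andP[xB xZ].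
  by have := B'Z' _ _ xB xZ; rewrite irr.
have cQ1 : #|B' :|: Z'| = 2 * q.
  by rewrite cardsU disjoint_setI0 // cards0 subn0 cB' cZ' mul2n addnn.
have [B2 [C [B2Q kB2 _ tC B2C]]] := step _ (q + s).-1 t cQ1 ltac:(lia) ltac:(lia).
(* Each half has [q] vertices and [B2] at least [q + s], so [B2] has at least [s] in both halves. *)
have cB2 : #|B2| <= #|B2 :&: B'| + #|B2 :&: Z'|.
  rewrite (leq_trans _ (leq_card_setU _ _)) // -setIUr.
  by rewrite subset_leq_card // subsetI subxx.
have : #|B2 :&: B'| <= q by rewrite -cB' subset_leq_card // subsetIr.
have : #|B2 :&: Z'| <= q by rewrite -cZ' subset_leq_card // subsetIr.
move=> h1 h2.
apply: (@complete_tripartite_copy _ _ _ _ _ (B2 :&: B') (B2 :&: Z') C) => //; try lia.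
- by move=> x y; rewrite !inE => /andP[_ xB] /andP[_ yZ]; apply: B'Z'.
- by move=> x y; rewrite !inE => /andP[xB _] yC; apply: B2C.
- by move=> x y; rewrite !inE => /andP[xB _] yC; apply: B2C.
Qed.

(** Pointwise, a point in [j] of the three sets satisfies [j <= 1 + j * (j - 1) / 2]. *)
Lemma card3_le (T : finType) (A B C : {set T}) :
  #|A| + #|B| + #|C| <= #|T| + #|A :&: B| + #|B :&: C| + #|A :&: C|.
Proof.
have cE (D : {set T}) : #|D| = \sum_(w : T) (w \in D).
  by rewrite -sum1_card big_mkcond; apply: eq_bigr => w _; case: (w \in D).
rewrite -[#|T|]sum1_card !cE -!big_split; apply: leq_sum => w _ /=.
by rewrite !inE; do 3!case: (_ \in _).
Qed.

(** A copy avoiding the new edge would already lie in [e]; symmetry of [h] fixes the orientation. *)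
Lemma add_edge_copy (U T : finType) (h : rel U) (e : rel T) (u v : T) (f : U -> T) :
  symmetric h -> graph_free h e -> injective f ->
  (forall x y, h x y -> add_edge e u v (f x) (f y)) ->
  exists x y, [/\ h x y, f x = u & f y = v].
Proof.
move=> symh free fi fh.
case: (boolP [exists x, [exists y, [&& h x y, f x == u & f y == v]]]).
  by move=> /existsP[x /existsP[y /and3P[hxy /eqP fx /eqP fy]]]; exists x, y.
rewrite negb_exists => /forallP no; case: free; exists f; split=> // x y hxy.
have := fh x y hxy; rewrite /add_edge /= => /or3P[//||] /andP[fx fy].
  by have := no x; rewrite negb_exists => /forallP/(_ y); rewrite hxy fx fy.
by have := no y; rewrite negb_exists => /forallP/(_ x); rewrite symh hxy fx fy.
Qed.

Lemma complete_tripartite_sym (r s t : nat) : symmetric (complete_tripartite r s t).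
Proof. by move=> x y; rewrite /complete_tripartite /= eq_sym. Qed.

Lemma third_part (r s t : nat) (x y : 'I_r + 'I_s + 'I_t) :
  0 < r -> 0 < s -> 0 < t -> complete_tripartite r s t x y ->
  exists2 z, complete_tripartite r s t x z & complete_tripartite r s t y z.
Proof.
move=> r0 s0 t0.
have ord3 (a b : nat) : a < 3 -> b < 3 -> inord a == inord b :> 'I_3 = (a == b).
  by move=> a3 b3; rewrite -val_eqE /= !inordK.
pose a : 'I_r + 'I_s + 'I_t := inl (inl (Ordinal r0)).
pose b : 'I_r + 'I_s + 'I_t := inl (inr (Ordinal s0)).
pose c : 'I_r + 'I_s + 'I_t := inr (Ordinal t0).
case: x => [[]|] i; case: y => [[]|] j; rewrite /complete_tripartite /= ?ord3 //= => _;
  first [by exists a; rewrite /= ?ord3 | by exists b; rewrite /= ?ord3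
        | by exists c; rewrite /= ?ord3].
Qed.

(** The copy created by the edge [u v] uses that edge, which lies in a triangle of the copy; the
    other two edges of the triangle are old. *)
Lemma common_neighbor (T : finType) (e : rel T) (r s t : nat) (u v : T) :
  0 < r -> 0 < s -> 0 < t ->
  symmetric e -> maximal_free (complete_tripartite r s t) e ->
  u != v -> ~~ e u v -> exists2 z, e u z & e v z.
Proof.
move=> r0 s0 t0 sym [free maxe] uv nuv; have [f [fi fh]] := maxe u v uv nuv.
have [x [y [hxy fx fy]]] := add_edge_copy (@complete_tripartite_sym r s t) free fi fh.
have [z hxz hyz] := third_part r0 s0 t0 hxy.
have zx : f z == u = false.
  by apply/negP; rewrite -fx => /eqP/fi zx; rewrite zx /complete_tripartite /= eqxx in hxz.
have zy : f z == v = false.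
  by apply/negP; rewrite -fy => /eqP/fi zy; rewrite zy /complete_tripartite /= eqxx in hyz.
exists (f z).
  by have := fh _ _ hxz; rewrite /add_edge /= zx zy !andbF !orbF fx.
by have := fh _ _ hyz; rewrite /add_edge /= zx zy !andbF !orbF fy.
Qed.

Lemma codegree_adjacent (T : finType) (e : rel T) (t : nat) (u v : T) :
  symmetric e -> irreflexive e -> graph_free (complete_tripartite 1 1 t) e ->
  e u v -> #|neighbors e u :&: neighbors e v| < t.
Proof.
move=> sym irr free euv; rewrite ltnNge; apply/negP => tN; apply: free.
apply: (@complete_tripartite_copy _ _ _ _ _ [set u] [set v] _ sym irr _ _ tN).
- by rewrite cards1.
- by rewrite cards1.
- by move=> x y; rewrite !inE => /eqP-> /eqP->.
- by move=> x y; rewrite !inE => /eqP-> /andP[].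
- by move=> x y; rewrite !inE => /eqP-> /andP[].
Qed.

(** Amounts to [k <= 2 ^ (k - 1)]. *)
Lemma mul_exp2_sub_le (d k : nat) : k <= d -> k * 2 ^ (d - k) <= 2 ^ d.-1.
Proof.
case: k => [|k] kd; first by rewrite mul0n.
have -> : d.-1 = k + (d - k.+1) by lia.
by rewrite expnD leq_mul2r ltn_expl // orbT.
Qed.

(* A shattered [S] whose traces are separated by codegree is small: delete from
   [N(v_A)] the few points seen by [A] and count the triples [(x, A, w)] with
   [x \in S :\: A] and [w] a remaining neighbor of [x]. The set [S :&: N(w)] is
   disjoint from [A], so [w] is in at most [k * 2 ^ (d - k) <= 2 ^ (d - 1)]
   triples, where [k = #|S :&: N(w)|]. *)
Lemma shattered_codegree_gap (T : finType) (e : rel T) (S : {set T}) (L t : nat) :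
  0 < #|T| -> symmetric e -> shattered e S ->
  (forall u v, e u v -> #|neighbors e u :&: neighbors e v| <= t) ->
  (forall u v, ~~ e u v ->
     #|T| + L * (#|S| * t) <= L * #|neighbors e u :&: neighbors e v|) ->
  #|S| <= L.
Proof.
move=> T0 sym /shatteredP shS adj nadj; set d := #|S|.
have [d0|d0] := posnP d; first by rewrite d0.
have [v vP] : exists v : {set T} -> T, forall A, neighbors e (v A) :&: S = A :&: S.
  apply: (@fin_all_exists {set T} (fun=> T)
            (fun A w => neighbors e w :&: S = A :&: S)) => A.
  by apply: shS; rewrite subsetIr.
pose W A := neighbors e (v A) :\: \bigcup_(y in A) neighbors e y.
(* Since [x \notin A], the vertices [x] and [v A] are nonadjacent and have a large codegree. Every
   [y \in A] is adjacent to [v A], so passing to [W A] costs at most [d * t] points. *)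
have lbW (x : T) (A : {set T}) : x \in S -> A \subset S :\ x ->
    #|T| <= L * #|neighbors e x :&: W A|.
  move=> xS; rewrite subsetD1 => /andP[AS xA].
  have nvx : ~~ e x (v A).
    have := congr1 (fun B : {set T} => x \in B) (vP A).
    by rewrite /= !inE xS (negPf xA) !andbT sym => ->.
  have rem : #|\bigcup_(y in A) (neighbors e y :&: neighbors e (v A))| <= d * t.
    apply: (@leq_trans (\sum_(y in A) t)); last first.
      by rewrite sum_nat_const leq_mul2r subset_leq_card ?orbT.
    apply: (@leq_trans (\sum_(y in A) #|neighbors e y :&: neighbors e (v A)|)).
      elim/big_rec2: _ => [|y n B _ IH]; first by rewrite cards0.
      by rewrite (leq_trans (leq_card_setU _ _)) // leq_add2l.
    apply: leq_sum => y yA; apply: adj.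
    have := congr1 (fun B : {set T} => y \in B) (vP A).
    by rewrite /= !inE (subsetP AS _ yA) yA !andbT sym => ->.
  have : #|neighbors e x :&: neighbors e (v A)| <= #|neighbors e x :&: W A| + d * t.
    apply: leq_trans (leq_add (leqnn _) rem).
    apply: leq_trans (leq_card_setU _ _); apply: subset_leq_card.
    apply/subsetP => w; rewrite !inE => /andP[xw vw]; rewrite xw vw /= andbT.
    case: (boolP (w \in _)) => //= /bigcupP[y yA]; rewrite inE => yw.
    by apply/bigcupP; exists y => //; rewrite !inE yw.
  move=> codeg_le; rewrite -(leq_add2r (L * (d * t))) (leq_trans (nadj _ _ nvx)) //.
  by rewrite -mulnDr leq_mul2l codeg_le orbT.
pose tot := \sum_(x in S) \sum_(A in powerset (S :\ x)) #|neighbors e x :&: W A|.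
have lb : d * 2 ^ d.-1 * #|T| <= L * tot.
  rewrite -mulnA; apply: sum_lower => x xS.
  rewrite (_ : 2 ^ d.-1 = #|powerset (S :\ x)|); last first.
    by rewrite card_powerset /d (cardsD1 x S) xS.
  by apply: sum_lower => A; rewrite powersetE; apply: lbW.
have ub : tot <= #|T| * 2 ^ d.-1.
  pose p w := neighbors e w :&: S.
  apply: (@leq_trans (\sum_(w : T) #|p w| * 2 ^ (d - #|p w|))); last first.
    rewrite -sum_nat_const; apply: leq_sum => w _; apply: mul_exp2_sub_le.
    by rewrite subset_leq_card // subsetIr.
  (* Adjacency of [w] to [v A] is dropped; that [w] avoids the neighborhoods of [A] becomes
     [A \subset S :\: p w]. *)
  apply: (@leq_trans (\sum_(x in S) \sum_(A in powerset S) \sum_(w : T)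
                        (x \in p w) * (A \subset S :\: p w))).
    apply: leq_sum => x xS.
    rewrite [X in _ <= X](bigID [pred A : {set T} | A \subset S :\ x]) /=.
    rewrite -[X in X <= _]addn0 leq_add // [X in X <= _]big_mkcond.
    rewrite [X in _ <= X]big_mkcond; apply: leq_sum => A _ /=.
    rewrite !powersetE; case: ifP => // AS.
    have AS' := AS; rewrite subsetD1 in AS'; case/andP: AS' => AS' xA; rewrite AS' /=.
    rewrite -sum1_card big_mkcond; apply: leq_sum => w _ /=; case: ifP => //.
    rewrite !inE => /and3P[xw nw vw]; rewrite sym xw xS /= mul1n lt0b.
    apply/subsetP => y yA; rewrite !inE (subsetP AS' _ yA) !andbT.
    by apply: contra nw => wy; apply/bigcupP; exists y => //; rewrite inE sym.
  rewrite (eq_bigr (fun x => \sum_(w : T) \sum_(A in powerset S)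
      (x \in p w) * (A \subset S :\: p w))); last by move=> x _; rewrite exchange_big.
  rewrite exchange_big; apply: leq_sum => w _ /=.
  rewrite (eq_bigr (fun x => (x \in p w) * 2 ^ (d - #|p w|))); last first.
    move=> x _; rewrite -big_distrr /=; congr (_ * _).
    rewrite /d -(cardsDS (subsetIr _ _)) -/(p w) -card_powerset -sum1_card.
    rewrite big_mkcond [RHS]big_mkcond; apply: eq_bigr => A _; rewrite !powersetE.
    case: (boolP (A \subset S :\: p w)) => [/subset_trans -> //|]; first exact: subsetDl.
    by case: ifP.
  rewrite -big_distrl leq_mul2r; apply/orP; right.
  rewrite -sum1_card [X in X <= _]big_mkcond [X in _ <= X]big_mkcond.
  by apply: leq_sum => x _; rewrite /p !inE; case: (x \in S); case: (e w x).
have : d * (2 ^ d.-1 * #|T|) <= L * (2 ^ d.-1 * #|T|).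
  by rewrite mulnA (leq_trans lb) // leq_mul2l mulnC ub orbT.
by rewrite leq_pmul2r // muln_gt0 T0 expn_gt0.
Qed.

Lemma VC_bounded_K11t (K t : nat) : 0 < K -> 0 < t ->
  exists C, forall (T : finType) (e : rel T), symmetric e -> irreflexive e ->
    maximal_free (complete_tripartite 1 1 t) e ->
    (forall v, (K + 1) * #|T| <= 3 * K * degree e v) -> VC_dim e <= C.
Proof.
move=> K0 t0; pose N0 := 4 * K * (3 + 2 * K) * t.
exists (maxn N0 (2 * K)) => T e sym irr maxe deg.
have [small|big] := leqP #|T| N0.
  by rewrite (leq_trans (VC_dim_le_card e)) // leq_max small.
suff : VC_dim e <= 2 * K by move=> h; rewrite leq_max h orbT.
apply: VC_dim_le => S shS cS.
suff : #|S| <= 2 * K by rewrite cS ltnn.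
have adj u v : e u v -> #|neighbors e u :&: neighbors e v| <= t.
  by move=> euv; apply: ltnW; apply: codegree_adjacent euv => //; case: maxe.
(* A common neighbor [z] of nonadjacent [u], [v] has codegree at most [t] with each, so [card3_le]
   bounds the codegree of [u] and [v] below by about [#|T| / K]. Twice that much is needed against
   [L = 2 * K], and [N0] absorbs the terms in [t]. *)
apply: (@shattered_codegree_gap _ e S (2 * K) t) => //; first by lia.
move=> u v nuv; rewrite cS.
have [->|uv] := eqVneq u v.
  by rewrite setIid; have := deg v; rewrite /degree /N0 in big *; nia.
have [z uz vz] := @common_neighbor _ e 1 1 t u v isT isT t0 sym maxe uv nuv.
have := card3_le (neighbors e u) (neighbors e z) (neighbors e v).
have := adj _ _ uz; have := adj _ _ vz; rewrite (setIC _ (neighbors e z)).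
have := deg u; have := deg v; have := deg z; rewrite /degree /N0 in big *; nia.
Qed.

(** * Near-bipartite structure *)

(** Pointwise, [j] vertices of a 5-cycle span at least [j - 2] edges, because its independence
    number is 2. *)
Lemma card5_cycle_le (T : finType) (A B C D F : {set T}) :
  #|A| + #|B| + #|C| + #|D| + #|F| <= 2 * #|T| +
  (#|A :&: B| + #|B :&: C| + #|C :&: D| + #|D :&: F| + #|F :&: A|).
Proof.
have cE (X : {set T}) : #|X| = \sum_(w : T) (w \in X).
  by rewrite -sum1_card big_mkcond; apply: eq_bigr => w _; case: (w \in X).
rewrite mulnC -sum_nat_const !cE -!big_split; apply: leq_sum => w _ /=.
by rewrite !inE; do 5!case: (_ \in _).
Qed.

Definition apex (s t : nat) : 'I_1 + 'I_s + 'I_t := inl (inl ord0).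
Definition second (s t : nat) (j : 'I_s) : 'I_1 + 'I_s + 'I_t := inl (inr j).
Definition third (s t : nat) (j : 'I_t) : 'I_1 + 'I_s + 'I_t := inr j.

Lemma tripartite_partE (r s t : nat) (x : 'I_r + 'I_s + 'I_t) :
  nat_of_ord (tripartite_part x) =
  match x with inl (inl _) => 0 | inl (inr _) => 1 | inr _ => 2 end.
Proof. by case: x => [[]|] i; rewrite /= inordK. Qed.

Lemma complete_tripartiteE (r s t : nat) (x y : 'I_r + 'I_s + 'I_t) :
  complete_tripartite r s t x y =
  match x, y with
  | inl (inl _), inl (inl _) | inl (inr _), inl (inr _) | inr _, inr _ => false
  | _, _ => true
  end.
Proof.
rewrite /complete_tripartite /= -val_eqE /= !tripartite_partE.
by case: x => [[]|] ?; case: y => [[]|] ?.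
Qed.

(** The apex sees all of [A] and [B] on its side, a vertex outside [A] sees all of [~: B] on its
    side, and a vertex outside [B] sees all of [~: A]. The conclusion forces [t < 2 * s - 2], which
    is where the case distinction on [t] comes from. *)
Lemma low_degree_split (s t : nat) (b : 'I_1 + 'I_s + 'I_t -> bool) :
  s <= t ->
  (forall u, #|[set w | complete_tripartite 1 s t u w & b w == b u]| < s) ->
  exists A : {set 'I_s}, exists B : {set 'I_t},
    [/\ forall j, (j \in A) = (b (second t j) == b (apex s t)),
        forall j, (j \in B) = (b (third s j) == b (apex s t)),
        0 < #|A|, 0 < #|B| & #|A| + #|B| < s /\ t < s + #|B|].
Proof.
move=> st deg; pose c := apex s t.
pose A := [set j : 'I_s | b (second t j) == b c].
pose B := [set j : 'I_t | b (third s j) == b c].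
have secI : injective (@second s t) by move=> x y [].
have thiI : injective (@third s t) by move=> x y [].
have cAB : #|A| + #|B| < s.
  apply: leq_ltn_trans (deg c).
  rewrite -(card_imset _ secI) -(card_imset _ thiI).
  rewrite -(leq_add2r #|(@second s t) @: A :&: (@third s t) @: B|) -cardsUI.
  rewrite (_ : _ :&: _ = set0) ?cards0 ?addn0; last first.
    apply/setP => x; rewrite !inE; apply/negP => /andP[/imsetP[j _ ->] /imsetP[k _]].
    by [].
  apply: subset_leq_card; apply/subsetP => x; rewrite !inE complete_tripartiteE.
  by case/orP => /imsetP[j]; rewrite inE => bj ->.
have [j jA] : exists j, j \notin A.
  have : #|~: A| > 0 by rewrite cardsCs setCK card_ord; lia.
  by case/card_gt0P => j; rewrite inE; exists j.
have cB : #|~: B| < s.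
  apply: leq_ltn_trans (deg (second t j)).
  rewrite -(card_imset _ thiI); apply: subset_leq_card; apply/subsetP => x.
  case/imsetP => k; rewrite !inE complete_tripartiteE => kB -> /=.
  by move: kB jA; rewrite inE; do 3!case: (b _).
have [k kB] : exists k, k \notin B.
  have : #|~: B| > 0 by rewrite cardsCs setCK card_ord; lia.
  by case/card_gt0P => k; rewrite inE; exists k.
have cA : #|~: A| < s.
  apply: leq_ltn_trans (deg (third s k)).
  rewrite -(card_imset _ secI); apply: subset_leq_card; apply/subsetP => x.
  case/imsetP => i; rewrite !inE complete_tripartiteE => iA -> /=.
  by move: iA kB; rewrite inE; do 3!case: (b _).
have := cardsC A; have := cardsC B; rewrite !card_ord => hB hA.
have A0 : 0 < #|A| by rewrite -(ltn_add2r #|~: A|) hA.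
have tB : t < s + #|B| by rewrite -[X in X < _]hB addnC ltn_add2r.
exists A, B; split=> //; try by move=> i; rewrite inE.
by move: tB; case: #|B| => //; rewrite addn0 ltnNge st.
Qed.

Section NearBipartite.
Variables (T : finType) (e : rel T) (s t K n : nat).
Let E := (2 * s + 1) * K.
Let M := E * s.
Hypotheses (sym : symmetric e) (irr : irreflexive e).
Hypotheses (K0 : 0 < K) (s2 : 1 < s) (st : s <= t).
Hypothesis nE : #|T| = n.
Hypothesis free : graph_free (complete_tripartite 1 s t) e.
Hypothesis deg : forall v, (s * K + 1) * n <= (2 * s + 1) * K * degree e v.
Hypothesis big : M * (2 ^ M * t) + E * ((s + 1) * (2 ^ (s + 1) * t)) + 2 * E * M < n.

Let bigEM : 2 * E * M < n.
Proof. exact: leq_ltn_trans (leq_addl _ _) big. Qed.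

Let far (u v : T) := E * #|neighbors e u :&: neighbors e v| < n.

Let far_sym u v : far u v = far v u.
Proof. by rewrite /far setIC. Qed.

Let E0 : 0 < E. Proof. by rewrite muln_gt0 addn1. Qed.

(** The cutoff [n / E] of [far] equals the slack in the degree bound. By [card5_cycle_le] the five
    slacks cancel against the five codegrees, leaving [5 * s * K < 2 * E], that is, [s < 2]. *)
Lemma no_far_5walk (a b c d f : T) :
  far a b -> far b c -> far c d -> far d f -> far f a -> False.
Proof.
rewrite /far => h1 h2 h3 h4 h5.
have := card5_cycle_le (neighbors e a) (neighbors e b) (neighbors e c)
  (neighbors e d) (neighbors e f).
rewrite nE -(leq_pmul2l E0) !mulnDr.
have := deg a; have := deg b; have := deg c; have := deg d; have := deg f.
rewrite /degree -/E.
have : 2 * K * n <= s * K * n by rewrite !leq_mul2r s2 !orbT.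
have : E * (2 * n) = 4 * (s * K * n) + 2 * K * n by rewrite /E; lia.
rewrite !mulnDl !mul1n.
move: h1 h2 h3 h4 h5; lia.
Qed.

(** Among [M = E * s] close neighbors, each has at least [n / E] neighbors in [neighbors e x], in
    total [s * n]. The pigeonhole then finds [s] of them with more than [t] common neighbors there,
    a copy with apex [x]. *)
Lemma close_neighbors_lt (x : T) : #|[set y in neighbors e x | ~~ far x y]| < M.
Proof.
rewrite ltnNge; apply/negP => /subset_of_card[Q /subsetP sQ cQ].
have lb : #|Q| * n <= E * \sum_(y in Q) #|neighbors e y :&: neighbors e x|.
  apply: sum_lower => y /sQ; rewrite inE => /andP[_].
  by rewrite /far -leqNgt setIC.
rewrite cQ -mulnA leq_pmul2l // in lb.
have [|B [Z [BQ sB ZN tZ BZ]]] := @trace_pigeonhole _ e Q (neighbors e x) s.-1 t sym.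
  have : s.-1 * #|neighbors e x| <= s.-1 * n by rewrite leq_mul2l -nE max_card orbT.
  rewrite cQ; move: big lb; nia.
apply: free; apply: (@complete_tripartite_copy _ _ _ _ _ [set x] B Z) => //.
- by rewrite cards1.
- by lia.
- by lia.
- move=> u v; rewrite inE => /eqP-> /(subsetP BQ)/sQ; rewrite inE => /andP[].
  by rewrite inE.
- by move=> u v; rewrite inE => /eqP-> /(subsetP ZN); rewrite inE.
Qed.

(** Close vertices have more than [2 * M] common neighbors, and fewer than [2 * M] of these are
    close to [a] or to [b]. *)
Let common_far (a b : T) : ~~ far a b ->
  exists p, far a p /\ far p b.
Proof.
rewrite {1}/far -leqNgt => cab.
pose X (x : T) := [set y in neighbors e x | ~~ far x y].
have : #|X a :|: X b| < #|neighbors e a :&: neighbors e b|.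
  rewrite (leq_ltn_trans (leq_card_setU _ _)) //.
  have := close_neighbors_lt a; have := close_neighbors_lt b; rewrite -/(X a) -/(X b).
  move: cab big; nia.
rewrite ltnNge; case: (boolP (neighbors e a :&: neighbors e b \subset X a :|: X b)).
  by move=> /subset_leq_card ->.
move=> /subsetPn[p]; rewrite !inE => /andP[-> ->] /=.
by rewrite negb_or !negbK => /andP[ap bp] _; exists p; rewrite (far_sym p).
Qed.

(** A far pair [a c] would close the far walk [a p b q c] to length 5. *)
Let close_trans (a b c : T) : ~~ far a b -> ~~ far b c -> ~~ far a c.
Proof.
move=> /common_far[p [ap pb]] /common_far[q [bq qc]]; apply/negP => ac.
by apply: (no_far_5walk ap pb bq qc); rewrite far_sym.
Qed.

(* Being close is an equivalence relation with exactly two classes. *)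
Lemma near_bipartite : exists side : T -> bool,
  forall v, #|[set w in neighbors e v | side w == side v]| < s.
Proof.
have [x0 _] : exists x : T, x \in T by apply/card_gt0P; rewrite nE; apply: leq_trans big.
pose side y := ~~ far x0 y.
pose V b := [set y | side y == b].
have same u v : side u = side v -> ~~ far u v.
  rewrite /side; case: (boolP (far x0 v)) => /= x0v; last first.
    by move=> x0u; apply: close_trans x0v; rewrite far_sym.
  (* A far triangle [x0 u v] yields a closed 5-walk by going along [x0 u] three times. *)
  move/negbFE => x0u; apply/negP => uv; apply: (@no_far_5walk x0 u x0 u v) => //.
  - by rewrite far_sym.
  - by rewrite far_sym.
(* Vertices of one class are close, so [v] has fewer than [M] neighbors in its own class. *)
have cross v : (s * K + 1) * n <= E * #|neighbors e v :&: V (~~ side v)| + E * M.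
  apply: leq_trans (deg v) _; rewrite -/E -mulnDr leq_pmul2l //.
  apply: (@leq_trans (#|neighbors e v :&: V (~~ side v)| +
                      #|[set y in neighbors e v | ~~ far v y]|)); last first.
    by rewrite leq_add2l ltnW // close_neighbors_lt.
  apply: leq_trans (leq_card_setU _ _); apply: subset_leq_card.
  apply/subsetP => y yN; rewrite in_setU !inE; move: (yN); rewrite inE => -> /=.
  case: (eqVneq (side y) (side v)) => [/esym/same ->|]; first by rewrite orbT.
  by case: (side y); case: (side v).
have VC b : #|V b| + #|V (~~ b)| = n.
  rewrite -nE -(cardsC (V b)); congr (_ + _); apply: eq_card => y; rewrite !inE.
  by case: (side y); case: b.
(* The vertex [x0] makes the opposite class large, and any vertex there makes the class of [x0]
   large. *)
have Vne b : (s * K + 1) * n <= E * #|V b| + E * M.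
  have out v : (s * K + 1) * n <= E * #|V (~~ side v)| + E * M.
    apply: leq_trans (cross v) _.
    by rewrite leq_add2r leq_pmul2l // subset_leq_card // subsetIr.
  have x0T : side x0.
    rewrite /side /far setIid -leqNgt; have := deg x0; rewrite -/E /degree; nia.
  have V1 := out x0; rewrite x0T /= in V1.
  have n_le : n <= (s * K + 1) * n by rewrite leq_pmull // addn1.
  have : 0 < E * #|V false| by move: V1 bigEM n_le; lia.
  rewrite muln_gt0 => /andP[_ /card_gt0P[y yV]].
  have V2 := out y; rewrite inE in yV; rewrite (eqP yV) /= in V2.
  by case: b.
(* Up to lower-order terms, each of the [s + 1] vertices of [x |: L] has at least
   [(s / (2 * s + 1) + 1 / E) * n] neighbors in the opposite class, which has at most
   [((s + 1) / (2 * s + 1) - 1 / E) * n] vertices. On average these see more than [s] of [x |: L],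
   so more than [t] of them see all of it. *)
exists side => x; rewrite ltnNge; apply/negP => /subset_of_card[L /subsetP sL cL].
have xL : x \notin L by apply/negP => /sL; rewrite !inE irr.
pose Q := x |: L.
have cQ : #|Q| = s + 1 by rewrite cardsU1 xL cL addnC.
pose W := V (~~ side x).
have [|B [Z [BQ sB _ tZ BZ]]] := @trace_pigeonhole _ e Q W s t sym.
  have lb : #|Q| * ((s * K + 1) * n - E * M) <=
            E * \sum_(y in Q) #|neighbors e y :&: W|.
    apply: sum_lower => y; rewrite !inE => yQ.
    have -> : W = V (~~ side y).
      by case/orP: yQ => [/eqP->//|/sL]; rewrite inE /W => /andP[_ /eqP->].
    by rewrite leq_subLR [E * M + _]addnC; apply: cross.
  rewrite -(ltn_pmul2l E0); apply: leq_trans lb.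
  have := VC (side x); have := Vne (side x); rewrite -/W cQ.
  set m := #|W|; set a := #|V _|; set P := (s + 1) * (_ * t); set X := E * M.
  set D := (s * K + 1) * n - X => Da am.
  have big' : E * P + 2 * X < n.
    by apply: leq_ltn_trans big; rewrite -/P -mulnA -/X; lia.
  have DX : D + X = (s * K + 1) * n by rewrite subnK //; move: big'; nia.
  have mD : E * m + D <= E * n by rewrite -am mulnDr; move: Da DX; lia.
  have smD : s * (E * m + D) <= s * (E * n) by rewrite leq_mul2l mD orbT.
  have EnE : s * (E * n) + (2 * s + 1) * n = (2 * s + 1) * (D + X).
    by rewrite DX /E; lia.
  have : (2 * s + 1) * (E * P + 2 * X) < (2 * s + 1) * n.
    by rewrite ltn_pmul2l // addn1.
  have -> : E * (s * m + P) = s * (E * m) + E * P by lia.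
  rewrite -/D; move: smD EnE; set Y := E * P; set Em := E * m; set En := E * n.
  have := leq0n (s * Y); have := leq0n (s * X); lia.
have BE : B = Q by apply/eqP; rewrite eqEcard BQ cQ addn1.
apply: free; apply: (@complete_tripartite_copy _ _ _ _ _ [set x] L Z) => //.
- by rewrite cards1.
- by rewrite cL.
- exact: ltnW.
- by move=> u v; rewrite inE => /eqP-> /sL; rewrite !inE => /andP[].
- by move=> u v; rewrite inE => /eqP-> vZ; apply: BZ => //; rewrite BE setU11.
- by move=> u v uL vZ; apply: BZ => //; rewrite BE setU1r.
Qed.
End NearBipartite.

(** Once the sides are completely joined, the trace of a vertex on [s + 1] vertices of one side is
    everything or has fewer than [s] elements; a trace of size exactly [s] is missing. *)
Lemma VC_bounded_near_bipartite (T : finType) (e : rel T) (s t : nat)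
    (side : T -> bool) :
  symmetric e -> maximal_free (complete_tripartite 1 s t) e ->
  s <= t -> 2 * s - 2 <= t ->
  (forall v, #|[set w in neighbors e v | side w == side v]| < s) ->
  VC_dim e <= 2 * s.
Proof.
move=> sym [free maxe] st s2t deg.
(* A copy created by a missing cross pair still has own-side degrees below [s], which
   [low_degree_split] excludes for [t >= 2 * s - 2]. *)
have full x y : side x != side y -> e x y.
  move=> xy; apply: contraT => nxy; have [|f [fi fh]] := maxe x y _ nxy.
    by apply: contraNneq xy => ->.
  have [|A [B [_ _ A0 B0 [AB tB]]]] := @low_degree_split s t (side \o f) st.
    move=> u; apply: leq_ltn_trans (deg (f u)).
    rewrite -(card_imset _ fi); apply: subset_leq_card; apply/subsetP => z.
    case/imsetP => w; rewrite inE => /andP[/fh uw sw] ->; rewrite !inE sw andbT.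
    move: uw; rewrite /add_edge /= => /or3P[//||] /andP[/eqP fu /eqP fw];
      by move: xy sw; rewrite /= -fu -fw; case: (side _); case: (side _).
  by lia.
apply: VC_dim_le => S shS cS.
have [b cb] : exists b, s < #|[set x in S | side x == b]|.
  have : #|S| <= #|[set x in S | side x == true]| + #|[set x in S | side x == false]|.
    apply: leq_trans (leq_card_setU _ _); apply: subset_leq_card.
    by apply/subsetP => x xS; rewrite !inE xS; case: (side x).
  by case: (ltnP s #|[set x in S | side x == true]|) => h h'; [exists true | exists false; lia].
have [S' /subsetP S'S cS'] := subset_of_card cb.
have /shatteredP shS' : shattered e S'.
  by apply: shattered_sub shS; apply/subsetP => x /S'S; rewrite inE => /andP[].
have [x xS'] : exists x, x \in S' by apply/card_gt0P; rewrite cS'.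
have [v vS'] := shS' _ (subsetDl S' [set x]).
have cx : #|S' :\ x| = s by have := cardsD1 x S'; rewrite xS' cS' => -[].
have [vb|vb] := eqVneq (side v) b.
  have := deg v; rewrite ltnNge -{1}cx -vS' => /negP; apply; apply: subset_leq_card.
  apply/subsetP => y; rewrite !inE => /andP[-> /S'S]; rewrite inE vb.
  by case/andP.
have : x \in S' :\ x.
  rewrite -vS' !inE xS' andbT; apply: full; apply: contra vb => /eqP ->.
  by have := S'S _ xS'; rewrite inE => /andP[].
by rewrite !inE eqxx.
Qed.

Lemma VC_bounded_K1st (K s t : nat) : 0 < K -> 1 < s -> s <= t -> 2 * s - 2 <= t ->
  exists C, forall (T : finType) (e : rel T), symmetric e -> irreflexive e ->
    maximal_free (complete_tripartite 1 s t) e ->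
    (forall v, (s * K + 1) * #|T| <= (2 * s + 1) * K * degree e v) ->
    VC_dim e <= C.
Proof.
move=> K0 s2 st s2t; pose E := (2 * s + 1) * K; pose M := E * s.
pose N0 := M * (2 ^ M * t) + E * ((s + 1) * (2 ^ (s + 1) * t)) + 2 * E * M.
exists (maxn N0 (2 * s)) => T e sym irr maxe deg.
have [small|big] := leqP #|T| N0.
  by rewrite (leq_trans (VC_dim_le_card e)) // leq_max small.
have [side sideP] := near_bipartite sym irr K0 s2 st erefl maxe.1 deg big.
by rewrite leq_max (VC_bounded_near_bipartite sym maxe st s2t sideP) orbT.
Qed.

(** * Extending gadgets to maximal graphs *)

Lemma add_edge_simple (T : finType) (e : rel T) (u v : T) :
  simple_graph e -> u != v -> simple_graph (add_edge e u v).
Proof.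
move=> [sym irr] uv; split=> x => [y|]; rewrite /add_edge /=.
  by rewrite sym; congr (_ || _); rewrite orbC; congr (_ || _); rewrite andbC.
rewrite irr /= andbC orbb; apply/negP => /andP[/eqP-> /eqP vu].
by rewrite vu eqxx in uv.
Qed.

Lemma maximal_extension (U T : finType) (h : rel U) (e : rel T) :
  simple_graph e -> graph_free h e ->
  exists e' : rel T, [/\ simple_graph e', maximal_free h e' & subrel e e'].
Proof.
have [n] := ubnP #|[set p : T * T | ~~ e p.1 p.2]|.
elim: n e => // n IH e lt_n simp free.
case: (pselect (exists u v, [/\ u != v, ~~ e u v & graph_free h (add_edge e u v)])).
  move=> [u [v [uv nuv freeuv]]].
  have [|e' [simp' max' sub']] := IH (add_edge e u v) _ (add_edge_simple simp uv) freeuv.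
    rewrite ltnS in lt_n; apply: leq_trans lt_n; apply: proper_card; apply/properP; split.
      by apply/subsetP => p; rewrite !inE negb_or => /andP[].
    by exists (u, v); rewrite !inE //= negbK /add_edge /= !eqxx orbT.
  by exists e'; split=> // x y exy; apply: sub'; rewrite /add_edge /= exy.
move=> nofree; exists e; split=> //; split=> // u v uv nuv.
by apply: contrapT => freeuv; apply: nofree; exists u, v.
Qed.

(** If [i \notin A], a free extension cannot join [x i] to [v A], since it would contain a copy
    lying in [add_edge e (x i) (v A)]. So these adjacencies are frozen and the range of [x] stays
    shattered. *)
Lemma gadget_lower_bound (U T : finType) (h : rel U) (e : rel T) (d D : nat)
    (x : 'I_d -> T) (v : {set 'I_d} -> T) :
  simple_graph e -> graph_free h e -> injective x ->
  (forall i (A : {set 'I_d}), i \in A -> e (x i) (v A)) ->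
  (forall i (A : {set 'I_d}), i \notin A -> contains_copy h (add_edge e (x i) (v A))) ->
  D <= #|T| -> (forall w, D <= degree e w) ->
  exists e' : rel T, [/\ simple_graph e', maximal_free h e',
    D <= min_degree e' & d <= VC_dim e'].
Proof.
move=> simp free xI adj nadj DT deg.
have [e' [simp' max' sub]] := maximal_extension simp free.
have e'E i (A : {set 'I_d}) : e' (x i) (v A) = (i \in A).
  apply/idP/idP => [e'xv|/adj/sub//]; apply: contraT => /nadj[f [fI fh]].
  case: (max'.1); exists f; split=> // y z /fh /or3P[/sub//||] /andP[/eqP-> /eqP->] //.
  by rewrite simp'.1.
exists e'; split=> //.
  apply: le_min_degree => // w; apply: leq_trans (deg w) _; apply: subset_leq_card.
  by apply/subsetP => y; rewrite !inE; apply: sub.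
have -> : d = #|x @: [set: 'I_d]| by rewrite card_imset // cardsT card_ord.
apply: (@leq_bigmax_cond _ _ (fun S : {set T} => #|S|)); apply/shatteredP => A /subsetP AS.
exists (v (x @^-1: A)); apply/setP => y; rewrite !inE; apply/andP/idP.
  by case=> + /imsetP[i _ yi]; rewrite yi simp'.1 e'E inE.
by move=> yA; have xy := AS _ yA; split=> //; case/imsetP: xy yA => i _ ->; rewrite simp'.1 e'E inE.
Qed.

(** As [c] is chosen before [N], the ratio [p * N / (q * N + c)] tends to [p / q] and eventually
    exceeds [g], while the VC-dimension is above the supposed bound. *)
Lemma not_admissible (R : realType) (U : finType) (h : rel U) (p q : nat) (g : R) :
  0 < q -> (0 <= g)%R -> (g < p%:R / q%:R)%R ->
  (forall d, exists c, forall N, exists (T : finType) (e : rel T),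
     [/\ simple_graph e, maximal_free h e, #|T| <= q * N + c,
         p * N <= min_degree e & d <= VC_dim e]) ->
  ~ VC_admissible h g.
Proof.
move=> q0 g0 gpq H [C VC_le]; have [c {}H] := H C.+1.
have q0R : (0 < q%:R :> R)%R by rewrite ltr0n.
have gap : (0 < p%:R - g * q%:R)%R by rewrite subr_gt0 -ltr_pdivlMr.
have [N gN] : exists N : nat, (g * c%:R < N%:R * (p%:R - g * q%:R))%R.
  exists (Num.bound (g * c%:R / (p%:R - g * q%:R))%R).
  by rewrite -ltr_pdivrMr // archi_boundP // divr_ge0 ?mulr_ge0 // ltW.
have [T [e [simp maxe cT De dV]]] := H N.
have := VC_le T e simp maxe; suff gT : (g * #|T|%:R <= (min_degree e)%:R)%R.
  by move=> /(_ gT); rewrite leqNgt dV.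
apply: (@le_trans _ _ ((p * N)%:R)%R); last by rewrite ler_nat.
apply: (@le_trans _ _ (g * (q * N + c)%:R)%R).
  by rewrite ler_wpM2l // ler_nat.
rewrite natrD !natrM; move: gN; set P := (p%:R)%R; set Q := (q%:R)%R; set M := (N%:R)%R.
by set X := (c%:R)%R => gN; lra.
Qed.

(** * Parts and degrees in complete tripartite graphs *)

Lemma leq_card_in_nat (T : finType) (A : {set T}) (g : T -> nat) (m : nat) :
  {in A &, injective g} -> {in A, forall x, g x < m} -> #|A| <= m.
Proof.
move=> gI gm; rewrite cardE -(size_map g) -[m](size_iota 0).
apply: uniq_leq_size.
  by rewrite map_inj_in_uniq ?enum_uniq // => x y; rewrite !mem_enum; apply: gI.
by move=> k /mapP[x]; rewrite mem_enum => /gm xm ->; rewrite mem_iota add0n.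
Qed.

Lemma complete_tripartite_irr (r s t : nat) : irreflexive (complete_tripartite r s t).
Proof. by move=> x; rewrite /complete_tripartite /= eqxx. Qed.

(** Transitivity of nonadjacency in contrapositive form; this is how complete multipartiteness
    enters the split gadget. *)
Lemma complete_tripartite_cotrans (r s t : nat) (u v w : 'I_r + 'I_s + 'I_t) :
  complete_tripartite r s t u w ->
  complete_tripartite r s t u v || complete_tripartite r s t v w.
Proof.
apply: contraTT; rewrite negb_or !negbK => /andP[/eqP-> /eqP->].
by rewrite eqxx.
Qed.

Lemma triangle_through (r s t : nat) (x : 'I_r + 'I_s + 'I_t) :
  0 < r -> 0 < s -> 0 < t ->
  exists y z, [/\ complete_tripartite r s t x y, complete_tripartite r s t x z &
    complete_tripartite r s t y z].
Proof.
move=> r0 s0 t0.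
have [y xy] : exists y, complete_tripartite r s t x y.
  case: x => [[]|] i.
  - by exists (inr (Ordinal t0)); rewrite complete_tripartiteE.
  - by exists (inr (Ordinal t0)); rewrite complete_tripartiteE.
  - by exists (inl (inl (Ordinal r0))); rewrite complete_tripartiteE.
by have [z xz yz] := third_part r0 s0 t0 xy; exists y, z.
Qed.

Definition part_index (r s t : nat) (x : 'I_r + 'I_s + 'I_t) : nat :=
  match x with inl (inl i) => i | inl (inr i) => i | inr i => i end.

Lemma part_index_inj (r s t : nat) (x y : 'I_r + 'I_s + 'I_t) :
  ~~ complete_tripartite r s t x y -> part_index x = part_index y -> x = y.
Proof.
rewrite complete_tripartiteE.
by case: x => [[]|] i; case: y => [[]|] j //= _ /val_inj ->.
Qed.

Lemma card_part_le (r s t : nat) (u : 'I_r + 'I_s + 'I_t) :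
  r <= s -> s <= t -> #|[set w | ~~ complete_tripartite r s t u w]| <= t.
Proof.
move=> rs st; apply: (@leq_card_in_nat _ _ (@part_index r s t)).
  move=> x y; rewrite !inE => ux uy; apply: part_index_inj.
  apply/negP => xy; have := complete_tripartite_cotrans u xy.
  by rewrite complete_tripartite_sym (negPf ux) (negPf uy).
by move=> x _; case: x => [[]|] i /=; apply: leq_trans (ltn_ord i) _ => //; apply: leq_trans st.
Qed.

Lemma card_part_ge (r s t : nat) (u : 'I_r + 'I_s + 'I_t) :
  r <= s -> s <= t -> r <= #|[set w | ~~ complete_tripartite r s t u w]|.
Proof.
move=> rs st.
have [f fI fu] : exists2 f : 'I_r -> 'I_r + 'I_s + 'I_t, injective f &
    forall i, ~~ complete_tripartite r s t u (f i).
  case: u => [[]|] j.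
  - by exists (fun i => inl (inl i)) => [x y []//|i]; rewrite complete_tripartiteE.
  - exists (fun i => inl (inr (widen_ord rs i))) => [x y [] /val_inj//|i].
    by rewrite complete_tripartiteE.
  - exists (fun i => inr (widen_ord (leq_trans rs st) i)) => [x y [] /val_inj//|i].
    by rewrite complete_tripartiteE.
have cf : #|f @: [set: 'I_r]| = r by rewrite card_imset // cardsT card_ord.
apply: leq_trans (eq_leq (esym cf)) _; apply: subset_leq_card.
by apply/subsetP => x /imsetP[i _ ->]; rewrite inE.
Qed.

Lemma degree_complete_tripartite (r s t : nat) (u : 'I_r + 'I_s + 'I_t) :
  r <= s -> s <= t -> r + s <= #|[set w | complete_tripartite r s t u w]|.
Proof.
move=> rs st; have := card_part_le u rs st.
have := cardsC [set w | complete_tripartite r s t u w].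
rewrite !card_sum !card_ord (_ : ~: _ = [set w | ~~ complete_tripartite r s t u w]).
  by move=> + h; move: h; lia.
by apply/setP => w; rewrite !inE.
Qed.

(** * Stars *)

Lemma card_set_type (T : finType) : #|{set T}| = 2 ^ #|T|.
Proof.
rewrite -[in RHS]cardsT -card_powerset -cardsT; congr #|pred_of_set _|.
by apply/setP => A; rewrite powersetE finset.subsetT inE.
Qed.

Lemma card_le_degree (T I : finType) (e : rel T) (v : T) (f : I -> T) (A : {set I}) :
  injective f -> {in A, forall i, e v (f i)} -> #|A| <= degree e v.
Proof.
move=> fI ef; rewrite -(card_imset _ fI); apply: subset_leq_card.
by apply/subsetP => _ /imsetP[i iA ->]; rewrite inE ef.
Qed.

Section StarGadget.
Variables (s t d N : nat).
Let X : finType := ('I_(s * N) + 'I_d * 'I_s.+1)%type.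
Let Y : finType := ('I_s.+1 * 'I_N + ('I_t.-1 + {set 'I_d}))%type.

Definition star_cross (x : X) (y : Y) : bool :=
  match x, y with
  | inl _, _ => true
  | inr p, inl q => p.2 != q.1
  | inr _, inr (inl _) => true
  | inr p, inr (inr A) => (p.2 == ord0) == (p.1 \in A)
  end.

(* [d] disjoint stars [K_{1,s}] with vertices [(i, j)], [j <= s], centre
   [(i, 0)]. The [j]-th vertex misses the [j]-th of the [s + 1] large classes of
   [Y], so the common neighborhood of a star is the set of [t - 1] vertices
   ['I_t.-1], and joining [(i, 0)] to [A] adds [A] to it. *)
Definition star_graph : rel (X + Y)%type := fun v w =>
  match v, w with
  | inl x, inr y => star_cross x y
  | inr y, inl x => star_cross x y
  | inl (inr p), inl (inr q) => (p.1 == q.1) && ((p.2 == ord0) != (q.2 == ord0))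
  | _, _ => false
  end.

Lemma star_graph_simple : simple_graph star_graph.
Proof.
split=> [[[i|[i j]]|y] [[k|[k l]]|z]|[[i|[i j]]|y]] //=; last by rewrite !eqxx.
by rewrite eq_sym; congr (_ && _); rewrite eq_sym.
Qed.

Lemma star_graph_degree (v : X + Y) : s * N <= degree star_graph v.
Proof.
case: v => [[i|[i j]]|y].
- apply: (@leq_trans #|[set: 'I_s.+1 * 'I_N]|).
    by rewrite cardsT card_prod !card_ord leq_mul2r leqnSn orbT.
  by apply: (@card_le_degree _ _ _ _ (fun q => inr (inl q))) => // ? ? [].
- apply: (@leq_trans #|finset.setX [set~ j] [set: 'I_N]|).
    by rewrite cardsX cardsC1 cardsT !card_ord.
  apply: (@card_le_degree _ _ _ _ (fun q => inr (inl q))) => [? ? []//|[k l]].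
  by rewrite !inE /= andbT eq_sym.
- apply: (@leq_trans #|[set: 'I_(s * N)]|); first by rewrite cardsT card_ord.
  by apply: (@card_le_degree _ _ _ _ (fun q => inl (inl q))) => // ? ? [].
Qed.

Let inX (v : X + Y) : bool := if v is inl _ then true else false.

Let star_triangle (u v w : X + Y) : inX u -> inX v -> inX w ->
  star_graph u v -> star_graph u w -> star_graph v w -> False.
Proof.
move: u v w => [[?|[? j]]|?] [[?|[? k]]|?] [[?|[? l]]|?] //= _ _ _.
move=> /andP[_ jk] /andP[_ jl] /andP[_ kl].
by move: jk jl kl; do 3!case: (_ == ord0).
Qed.

(** [X] induces a triangle-free graph and [Y] an independent set, so exactly one part of a copy lies
    in [Y]. The other two parts are connected and have at least [s + 1] vertices, so they fill a
    whole star; the part in [Y] must then fit into its [t - 1] common neighbors, which leaves one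
    vertex too few. *)
Lemma star_graph_free : 0 < s -> s <= t ->
  graph_free (complete_tripartite 1 s t) star_graph.
Proof.
move=> s0 st [f [fI fh]]; pose h := complete_tripartite 1 s t.
have t0 : 0 < t by apply: leq_trans st.
have [u0 u0Y] : exists u0, ~~ inX (f u0).
  have [y [z [xy xz yz]]] := triangle_through (apex s t) (ltn0Sn 0) s0 t0.
  apply: contrapT => allX.
  have {}allX u : inX (f u) by apply: contraT => uY; case: allX; exists u.
  by apply: (star_triangle (allX _) (allX _) (allX _) (fh _ _ xy) (fh _ _ xz) (fh _ _ yz)).
have adjX u : h u0 u -> inX (f u).
  by move=> /fh; case: (f u0) u0Y => // ? _; case: (f u).
have nadjY u : ~~ h u0 u -> ~~ inX (f u).
  move=> nu; apply/negP => uX.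
  have [y [z [xy xz yz]]] := triangle_through u (ltn0Sn 0) s0 t0.
  have u0adj w : h u w -> h u0 w.
    by move=> /(complete_tripartite_cotrans u0); rewrite complete_tripartite_sym -/h (negPf nu).
  exact: (star_triangle uX (adjX _ (u0adj _ xy)) (adjX _ (u0adj _ xz)) (fh _ _ xy) (fh _ _ xz) (fh _ _ yz)).
have [y [z [xy xz yz]]] := triangle_through u0 (ltn0Sn 0) s0 t0.
have [i fi] : exists i, forall u, h u0 u -> exists j, f u = inl (inr (i, j)).
  have star_edge u v : h u0 u -> h u0 v -> h u v ->
      exists k j l, f u = inl (inr (k, j)) /\ f v = inl (inr (k, l)).
    move=> /adjX + /adjX + /fh.
    case: (f u) => [[?|[k j]]|?]; case: (f v) => [[?|[k' l]]|?] //= _ _ /andP[/eqP <- _].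
    by exists k, j, l.
  have [i [j [l [fy fz]]]] := star_edge _ _ xy xz yz.
  exists i => u u0u; have := complete_tripartite_cotrans u yz.
  rewrite complete_tripartite_sym => /orP[uy|uz].
    have [k [j' [l' [fu]]]] := star_edge _ _ u0u xy uy.
    by rewrite fy => -[ik _]; exists j'; rewrite fu ik.
  rewrite -/h in uz; have [k [j' [l' [fu]]]] := star_edge _ _ u0u xz uz.
  by rewrite fz => -[ik _]; exists j'; rewrite fu ik.
pose g u : 'I_s.+1 := if f u is inl (inr p) then p.2 else ord0.
pose A := [set u | h u0 u].
have gI : {in A &, injective g}.
  move=> u v; rewrite !inE /g => /fi[j fu] /fi[k fv]; rewrite fu fv /= => jk.
  by apply: fI; rewrite fu fv jk.
have onto j : exists2 u, h u0 u & f u = inl (inr (i, j)).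
  have : j \in g @: A.
    suff -> : g @: A = setT by [].
    apply/eqP; rewrite eqEcard finset.subsetT cardsT card_ord card_in_imset //.
    exact: (@degree_complete_tripartite 1 s t u0).
  case/imsetP => u; rewrite inE => u0u; have [k fu] := fi u u0u.
  by rewrite /g fu /= => ->; exists u.
pose B := [set u | ~~ h u0 u].
have BE u : u \in B -> exists l : 'I_t.-1, f u = inr (inr (inl l)).
  rewrite inE => nu; have adj j : star_graph (inl (inr (i, j))) (f u).
    have [w u0w <-] := onto j; apply: fh.
    rewrite complete_tripartite_sym.
    by have := complete_tripartite_cotrans u u0w; rewrite -/h (negPf nu).
  have := nadjY u nu; case: (f u) adj => // -[[j k] /(_ j)|[l|C] adj _]; first by rewrite /= eqxx.
    by exists l.
  (* A vertex [C] sees either only the centre or only the leaves of star [i]; [ord_max] is a leaf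
     because [s > 0]. *)
  have := adj ord0; have := adj ord_max; rewrite /= eqxx -val_eqE /= gtn_eqF //.
  by case: (i \in C).
have : #|B| <= t.-1.
  apply: (@leq_card_in_nat _ _ (fun u => if f u is inr (inr (inl l)) then l : nat else 0)).
    move=> u v /BE[k fu] /BE[l fv]; rewrite fu fv => /val_inj kl.
    by apply: fI; rewrite fu fv kl.
  by move=> u /BE[k ->].
have : #|A| <= s.+1.
  by rewrite -(card_in_imset gI) (leq_trans (max_card _)) // card_ord.
have := cardsC A; rewrite (_ : ~: A = B); last by apply/setP => u; rewrite !inE.
rewrite !card_sum !card_ord; move: t0; lia.
Qed.

Lemma star_graph_saturated (i : 'I_d) (A : {set 'I_d}) : 0 < t -> i \notin A ->
  contains_copy (complete_tripartite 1 s t)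
    (add_edge star_graph (inl (inr (i, ord0))) (inr (inr (inr A)))).
Proof.
move=> t0 iA; set x : X + Y := inl (inr (i, ord0)); set a : X + Y := inr (inr (inr A)).
have [sym irr] := @add_edge_simple _ star_graph x a star_graph_simple isT.
pose L : {set X + Y} := [set inl (inr (i, j)) | j in [set~ (ord0 : 'I_s.+1)]].
pose C : {set X + Y} := a |: [set inr (inr (inl l)) | l in [set: 'I_t.-1]].
have aC : a \notin [set inr (inr (inl l)) | l in [set: 'I_t.-1]].
  by apply/negP => /imsetP[].
have cC : #|C| = t.
  by rewrite cardsU1 aC card_imset ?cardsT ?card_ord ?add1n ?prednK // => ? ? [].
have cL : #|L| = s by rewrite card_imset ?cardsC1 ?card_ord // => ? ? [].
apply: (@complete_tripartite_copy _ _ _ _ _ [set x] L C) => //.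
- by rewrite cards1.
- by rewrite cL.
- by rewrite cC.
- move=> u v; rewrite inE => /eqP-> /imsetP[j]; rewrite !inE => /negPf j0 ->.
  by rewrite /add_edge /= eqxx j0.
- move=> u v; rewrite inE => /eqP->; rewrite !inE => /orP[/eqP->|/imsetP[l _ ->]].
    by rewrite /add_edge /= !eqxx orbT.
  by rewrite /add_edge.
- move=> u v /imsetP[j]; rewrite !inE => /negPf j0 -> /orP[/eqP->|/imsetP[l _ ->]].
    by rewrite /add_edge /= j0 (negPf iA).
  by rewrite /add_edge.
Qed.
End StarGadget.

Lemma not_admissible_star (R : realType) (s t : nat) (g : R) :
  0 < s -> s <= t -> (0 <= g)%R -> (g < s%:R / (2 * s + 1)%:R)%R ->
  ~ VC_admissible (complete_tripartite 1 s t) g.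
Proof.
move=> s0 st g0 gs; apply: (not_admissible _ g0 gs); first by rewrite addn1.
(* The large classes have [s * N] and [s.+1 * N] vertices, together [(2 * s + 1) * N]; the witness
   covers the rest. *)
move=> d; exists (d * s.+1 + t + 2 ^ d) => N.
have [|||||e' [simp' max' De' de']] := @gadget_lower_bound _ _
  (complete_tripartite 1 s t) _ d (s * N) (fun i => inl (inr (i, ord0)))
  (fun A => inr (inr (inr A))) (star_graph_simple s t d N) (star_graph_free s0 st).
- by move=> i j [].
- by move=> i A iA /=; rewrite iA.
- by move=> i A; apply: star_graph_saturated; apply: leq_trans st.
- by rewrite !(card_sum, card_prod, card_ord); lia.
- exact: star_graph_degree.
- eexists; exists e'; split=> //.
  by rewrite !(card_sum, card_prod, card_ord, card_set_type); lia.
Qed.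

(** * Split copies *)

Section SplitGadget.
Variables (U : finType) (h : rel U) (side : U -> bool) (x0 y0 x1 y1 : U) (d N : nat).
Let J : finType := ('I_d + {set 'I_d})%type.
Let T : finType := (bool * ('I_N + J * U))%type.

Definition split_cross (p q : J * U) : bool :=
  match p.1, q.1 with
  | inl i, inr A =>
    if i \in A then (p.2 == x0) && (q.2 == y0)
    else [&& side p.2, ~~ side q.2, h p.2 q.2 & (p.2, q.2) != (x0, y0)]
  | _, _ => false
  end.

(* A complete bipartite graph with sides indexed by [bool], to which copies of
   [h] split along [side] are attached: the half in side [true] is labelled by
   [i], the half in side [false] by [A]. For [i \notin A] the two halves form
   [h] minus the edge [(x0, y0)], for [i \in A] they are joined by that edge
   only. *)
Definition split_graph : rel T := fun v w =>
  match v.2, w.2 with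
  | inr p, inr q =>
    if v.1 == w.1 then [&& p.1 == q.1, side p.2 == v.1, side q.2 == v.1 & h p.2 q.2]
    else if v.1 then split_cross p q else split_cross q p
  | _, _ => v.1 != w.1
  end.

Hypotheses (hsym : symmetric h) (hirr : irreflexive h).

Lemma split_graph_simple : simple_graph split_graph.
Proof.
split=> [[b [i|[j u]]] [c [k|[l w]]]|[b [i|[j u]]]]; rewrite /split_graph /= ?eqxx //.
- by rewrite eq_sym.
- by rewrite eq_sym.
- by rewrite eq_sym.
- case: (eqVneq b c) => [->|bc]; last by case: b c bc => [] [].
  by rewrite /= eq_sym hsym; congr (_ && _); do 2!case: (side _ == _).
- by rewrite hirr !andbF.
Qed.

Lemma split_graph_degree (v : T) : N <= degree split_graph v.
Proof.
have <- : #|[set: 'I_N]| = N by rewrite cardsT card_ord.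
apply: (@card_le_degree _ _ _ _ (fun k => (~~ v.1, inl k))) => [k l [->]//|k _].
by case: v => [b [i|p]]; rewrite /split_graph /=; case: b.
Qed.

Lemma split_graph_saturated (i : 'I_d) (A : {set 'I_d}) :
  side x0 -> ~~ side y0 -> i \notin A ->
  contains_copy h (add_edge split_graph (true, inr (inl i, x0)) (false, inr (inr A, y0))).
Proof.
move=> sx sy iA.
pose j u : J := if side u then inl i else inr A.
exists (fun u => (side u, inr (j u, u))); split=> [u w []//|u w huw].
have cross v w' : side v -> ~~ side w' -> h v w' -> (v, w') != (x0, y0) ->
    split_cross (inl i, v) (inr A, w').
  by rewrite /split_cross /= (negPf iA) => -> -> -> ->.
rewrite /add_edge /split_graph /= /j.
case: (boolP (side u)) => su; case: (boolP (side w)) => sw /=.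
- by rewrite !eqxx huw.
- case: (eqVneq (u, w) (x0, y0)) => [[-> ->]|uw]; first by rewrite !eqxx orbT.
  by rewrite cross.
- case: (eqVneq (w, u) (x0, y0)) => [[-> ->]|wu]; first by rewrite !eqxx !orbT.
  by rewrite cross // hsym.
- by rewrite !eqxx huw.
Qed.

Lemma split_graph_own_edge (v w : T) : split_graph v w -> v.1 = w.1 ->
  exists j x y, [/\ v.2 = inr (j, x), w.2 = inr (j, y), side x = v.1, side y = v.1 & h x y].
Proof.
case: v w => [b [i|[j x]]] [c [k|[l y]]]; rewrite /split_graph /= => + bc; rewrite bc ?eqxx //.
by move=> /and4P[/eqP <- /eqP <- /eqP sy hxy]; exists j, x, y.
Qed.

(* If every vertex of a copy has a neighbor on its own side, the copy lives in a
   single pair of halves; this pair has [#|U|] vertices but lacks an edge of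
   [h]. *)
Lemma split_graph_free :
  (forall u v w, h u w -> h u v || h v w) ->
  side x0 -> ~~ side y0 -> h x0 y0 -> side x1 -> ~~ side y1 -> h x1 y1 ->
  (x1, y1) != (x0, y0) ->
  (forall f : U -> T, injective f -> (forall u w, h u w -> split_graph (f u) (f w)) ->
     forall u, exists2 w, h u w & (f w).1 = (f u).1) ->
  graph_free h split_graph.
Proof.
move=> hcot sx0 sy0 h0 sx1 sy1 h1 neq own [f [fI fh]].
have ownN := own f fI fh.
(* All vertices of the copy on side [b] lie in one half: given an edge [u w] on that side, any other
   vertex there is adjacent to [u] or [w] by [hcot]. An empty side gets the dummy label
   [inr set0]. *)
have [jb jbP] : exists jb : bool -> J, forall u, exists2 x,
    (f u).2 = inr (jb (f u).1, x) & side x = (f u).1.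
  have [jb jbP] : exists jb : bool -> J, forall b, forall u, (f u).1 = b -> exists2 x,
      (f u).2 = inr (jb b, x) & side x = b.
    apply: (@fin_all_exists bool (fun=> J) (fun b j => forall u, (f u).1 = b ->
      exists2 x, (f u).2 = inr (j, x) & side x = b)) => b.
    case: (pickP (fun u => (f u).1 == b)) => [u /eqP fu|none]; last first.
      by exists (inr set0) => u fu; have := none u; rewrite fu eqxx.
    have [w huw fw] := ownN u.
    have [j [x [y [fux fwy _ _ _]]]] := split_graph_own_edge (fh _ _ huw) (esym fw).
    exists j => v fv; case/orP: (hcot u v w huw) => hv.
      have [|j' [x' [y' [fux' -> _ sy' _]]]] := split_graph_own_edge (fh _ _ hv) _.
        by rewrite fu fv.
      by move: fux'; rewrite fux => -[-> _]; exists y'; rewrite // sy' fu.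
    have [|j' [x' [y' [-> fwy' sx' _ _]]]] := split_graph_own_edge (fh _ _ hv) _.
      by rewrite fw fu fv.
    by move: fwy'; rewrite fwy => -[-> _]; exists x'; rewrite // sx' fv.
  by exists jb => u; apply: jbP.
have [g gP] : exists g : U -> U, forall u, f u = (side (g u), inr (jb (side (g u)), g u)).
  apply: (@fin_all_exists U (fun=> U) (fun u x => f u = (side x, inr (jb (side x), x)))) => u.
  by have [x fux sx] := jbP u; exists x; rewrite sx -fux; case: (f u).
have gI : injective g by move=> u w guw; apply: fI; rewrite !gP guw.
(* An edge of [h] absent from this pair of halves: [(x0, y0)] if [i \notin A], and [(x1, y1)] if
   only [(x0, y0)] is present. Other combinations of labels have no cross edges at all. *)
pose bad := match jb true, jb false with
  | inl i, inr A => if i \in A then (x1, y1) else (x0, y0)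
  | _, _ => (x0, y0) end.
have badP : [/\ h bad.1 bad.2, side bad.1 & ~~ side bad.2].
  by rewrite /bad; case: (jb true) => [i|?]; case: (jb false) => [?|A] //; case: ifP.
have [hbad sbad1 sbad2] := badP.
have gh u w : h u w -> h (g u) (g w) && ((g u, g w) != bad).
  move=> /fh; rewrite !gP /split_graph /=.
  case: (eqVneq (side (g u)) (side (g w))) => [sgg /and4P[_ _ _ ->]|] /=.
    by apply/eqP => badE; move: sbad1 sbad2; rewrite -badE /= sgg => ->.
  case sgu: (side (g u)); case sgw: (side (g w)) => //= _.
    rewrite /split_cross /= /bad; case: (jb true) => [i|?]; case: (jb false) => [?|A] //.
    case: ifP => _; last by case/and4P => _ _ -> ->.
    by case/andP=> /eqP-> /eqP->; rewrite h0 eq_sym.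
  rewrite /split_cross; case: (jb true) => [i|?]; case: (jb false) => [?|A] //=.
  have nbad : (g u, g w) != bad by apply: contraTneq sbad1 => <- /=; rewrite sgu.
  rewrite nbad andbT hsym; case: ifP => _; last by case/and4P.
  by case/andP=> /eqP-> /eqP->; rewrite hsym.
(* The relabelling [g] would map the edges of [h] injectively into those other than [bad]. *)
pose D := [set p : U * U | h p.1 p.2].
pose G (p : U * U) := (g p.1, g p.2).
have GI : injective G by move=> [? ?] [? ?] [/gI -> /gI ->].
have : #|G @: D| < #|D|.
  apply: proper_card; apply/properP; split.
    by apply/subsetP => _ /imsetP[p + ->]; rewrite !inE => /gh/andP[].
  exists bad; rewrite ?inE //.
  by apply/negP => /imsetP[p]; rewrite inE => /gh/andP[_ /eqP + badE]; apply; rewrite badE.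
by rewrite card_imset // ltnn.
Qed.
Let lab (v : T) : U := if v.2 is inr p then p.2 else x0.

Let lab_inj (v w : T) (j : J) (x y : U) :
  v.1 = w.1 -> v.2 = inr (j, x) -> w.2 = inr (j, y) -> lab v = lab w -> v = w.
Proof.
by case: v w => [b z] [c z'] /= -> ->; rewrite /lab /= => -> ->.
Qed.

(** Own-side neighbors of [f u] lie in its half, where forgetting the label is injective; a copy
    thus inherits degree bounds from [side]. *)
Lemma split_graph_own_degree (f : U -> T) (u : U) :
  injective f -> (forall u w, h u w -> split_graph (f u) (f w)) ->
  exists x, #|[set w | h u w & (f w).1 == (f u).1]| <=
            #|[set w | h x w & side w == side x]|.
Proof.
move=> fI fh; set D := [set w | _ & _]; exists (lab (f u)).
have DP w : w \in D -> exists j x y, [/\ (f w).1 = (f u).1, (f u).2 = inr (j, x),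
    (f w).2 = inr (j, y), side x = side y & h x y].
  rewrite inE => /andP[/fh uw /eqP wu].
  have [j [x [y [fu fw sx sy hxy]]]] := split_graph_own_edge uw (esym wu).
  by exists j, x, y; rewrite sx sy.
have labI : {in D &, injective (lab \o f)}.
  move=> v w /DP[j [x [y [vu fu fv _ _]]]] /DP[j' [x' [y' [wu fu' fw _ _]]]] vw.
  move: fu'; rewrite fu => -[jj _]; rewrite -jj in fw.
  by apply: fI; apply: lab_inj fv fw vw; rewrite vu wu.
rewrite -(card_in_imset labI); apply: subset_leq_card; apply/subsetP => _ /imsetP[w wD ->].
have [j [x [y [_ fu fw sxy hxy]]]] := DP w wD.
by rewrite inE /lab /= fu fw /= hxy sxy eqxx.
Qed.

(** The neighborhood of [u] in [h] is connected, by the edge [y z] and [hcot]; if it is sent to one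
    side, it lies in a single half and embeds into [h] there. *)
Lemma split_graph_component (f : U -> T) (u : U) (b : bool) :
  injective f -> (forall u w, h u w -> split_graph (f u) (f w)) ->
  (forall u v w, h u w -> h u v || h v w) ->
  (exists y z, [/\ h u y, h u z & h y z]) ->
  (forall w, h u w -> (f w).1 = b) ->
  exists g : U -> U, [/\ {in [set w | h u w] &, injective g},
    forall w, h u w -> side (g w) = b &
    forall w w', h u w -> h u w' -> h w w' -> h (g w) (g w')].
Proof.
move=> fI fh hcot [y [z [uy uz yz]]] fb; exists (lab \o f).
have edge v w : h u v -> h u w -> h v w -> exists j x x',
    [/\ (f v).2 = inr (j, x), (f w).2 = inr (j, x'), side x = b, side x' = b & h x x'].
  move=> uv uw /fh/split_graph_own_edge[|j [x [x' [fv fw sx sx' hx]]]]; first by rewrite !fb.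
  by exists j, x, x'; rewrite sx sx' fb.
have [j [x [x' [fy fz _ _ _]]]] := edge _ _ uy uz yz.
have one v : h u v -> exists2 a, (f v).2 = inr (j, a) & side a = b.
  move=> uv; case/orP: (hcot _ v _ yz) => hv.
    have [j' [a' [a [fy' fv _ sa _]]]] := edge _ _ uy uv hv.
    by move: fy'; rewrite fy => -[jj _]; exists a; rewrite ?jj.
  have [j' [a [a' [fv fz' sa _ _]]]] := edge _ _ uv uz hv.
  by move: fz'; rewrite fz => -[jj _]; exists a; rewrite ?jj.
split=> [v w|v|v w] /=.
- rewrite !inE => uv uw /=; have [a fv _] := one v uv; have [c fw _] := one w uw.
  by move=> vw; apply: fI; apply: lab_inj fv fw vw; rewrite !fb.
- by move=> /one[a]; rewrite /lab => ->.
- move=> uv uw /(edge _ _ uv uw)[k [a [c [fv fw _ _ hac]]]].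
  by rewrite /lab fv fw.
Qed.
End SplitGadget.

(** * Splittings that give the value one half *)

Lemma not_admissible_split (R : realType) (U : finType) (h : rel U)
    (side : U -> bool) (x0 y0 x1 y1 : U) (g : R) :
  symmetric h -> irreflexive h ->
  (forall u v w, h u w -> h u v || h v w) ->
  side x0 -> ~~ side y0 -> h x0 y0 -> side x1 -> ~~ side y1 -> h x1 y1 ->
  (x1, y1) != (x0, y0) ->
  (forall d N (f : U -> bool * ('I_N + ('I_d + {set 'I_d}) * U)), injective f ->
     (forall u w, h u w -> split_graph h side x0 y0 (f u) (f w)) ->
     forall u, exists2 w, h u w & (f w).1 = (f u).1) ->
  (0 <= g)%R -> (g < 1 / 2)%R ->
  ~ VC_admissible h g.
Proof.
move=> hsym hirr hcot sx0 sy0 h0 sx1 sy1 h1 neq own g0 g2.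
apply: (@not_admissible R U h 1 2 g) => // d.
exists (2 * ((d + 2 ^ d) * #|U|)) => N.
have [|||||e' [simp' max' De' de']] := @gadget_lower_bound _ _ h _ d N
  (fun i => (true, inr (inl i, x0))) (fun A => (false, inr (inr A, y0)))
  (split_graph_simple side x0 y0 d N hsym hirr)
  (split_graph_free hsym hcot sx0 sy0 h0 sx1 sy1 h1 neq (own d N)).
- by move=> i j [].
- by move=> i A iA; rewrite /split_graph /split_cross /= iA !eqxx.
- by move=> i A; apply: split_graph_saturated.
- by rewrite !(card_prod, card_sum, card_ord, card_bool); lia.
- exact: split_graph_degree.
- eexists; exists e'; split=> //; last by rewrite mul1n.
  by rewrite !(card_prod, card_sum, card_ord, card_bool, card_set_type); lia.
Qed.

(** The halves are [K_{1,s}] and [K_{r-1,t}]. A vertex without own-side neighbors would have its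
    whole neighborhood inside one half, and neither half has room for it. *)
Lemma not_admissible_r2 (R : realType) (r s t : nat) (g : R) :
  1 < r -> r <= s -> s <= t -> (0 <= g)%R -> (g < 1 / 2)%R ->
  ~ VC_admissible (complete_tripartite r s t) g.
Proof.
move=> r2 rs st g0 g2.
have r0 : 0 < r by lia.
have s0 : 0 < s by lia.
have t0 : 0 < t by lia.
pose side (u : 'I_r + 'I_s + 'I_t) := match u with
  | inl (inl i) => i == 0 :> nat | inl (inr _) => true | inr _ => false end.
pose x0 : 'I_r + 'I_s + 'I_t := inl (inr (Ordinal s0)).
pose x1 : 'I_r + 'I_s + 'I_t := inl (inl (Ordinal r0)).
pose y0 : 'I_r + 'I_s + 'I_t := inr (Ordinal t0).
pose h := complete_tripartite r s t.
have hsym : symmetric h := @complete_tripartite_sym r s t.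
have hcot : forall u v w, h u w -> h u v || h v w := @complete_tripartite_cotrans r s t.
apply: (@not_admissible_split R _ h side x0 y0 x1 y0) => //; try by rewrite /h complete_tripartiteE.
  exact: complete_tripartite_irr.
move=> d N f fI fh u.
apply: contrapT => none.
have fb w : h u w -> (f w).1 = ~~ (f u).1.
  move=> uw; case: (eqVneq (f w).1 (f u).1) => [wu|]; last by case: (f w).1; case: (f u).1.
  by case: none; exists w.
have [y [z [uy uz yz]]] := triangle_through u r0 s0 t0.
have [|k [kI ks kh]] := split_graph_component fI fh hcot _ fb; first by exists y, z.
case: (~~ (f u).1) ks => ks.
  (* The half [K_{1,s}] has [s + 1] vertices, but [u] has at least [r + s > s + 1] neighbors. *)
  have : #|[set w | h u w]| <= s.+1.
    pose idx (w : 'I_r + 'I_s + 'I_t) : nat := match w with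
      | inl (inl _) => s | inl (inr j) => j | inr _ => 0 end.
    apply: (@leq_card_in_nat _ _ (idx \o k)).
      move=> v w vD wD /= kvw; apply: kI => //; move: vD wD kvw; rewrite !inE => /ks + /ks.
      case: (k v) => [[]|] i //=; case: (k w) => [[]|] j //=.
      - by move=> /eqP i0 /eqP j0 _; congr (inl (inl _)); apply: val_inj; rewrite /= i0 j0.
      - by move=> _ _ sj; have := ltn_ord j; rewrite -sj ltnn.
      - by move=> _ _ si; have := ltn_ord i; rewrite si ltnn.
      - by move=> _ _ /val_inj ->.
    move=> w; rewrite inE /= => /ks; case: (k w) => [[]|] i //= _.
    exact: ltnW (ltn_ord i).
  by have := degree_complete_tripartite u rs st; rewrite -/h; lia.
(* In [K_{r-1,t}], one of the two parts forming the neighborhood goes entirely to the [r - 1] core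
   vertices, yet every part has at least [r] vertices. *)
pose core (w : 'I_r + 'I_s + 'I_t) := if w is inl (inl _) then true else false.
have coreN w w' : h u w -> h u w' -> h w w' -> core (k w') = ~~ core (k w).
  move=> uw uw' ww'; have := ks _ uw; have := ks _ uw'; have := kh _ _ uw uw' ww'.
  by rewrite /h complete_tripartiteE; case: (k w) => [[]|] ?; case: (k w') => [[]|] ?.
have [p [q [up uq pq pc]]] : exists p q, [/\ h u p, h u q, h p q & core (k p)].
  case: (boolP (core (k y))) => [yc|/negPf yc]; first by exists y, z.
  exists z, y; split=> //; first by rewrite hsym.
  by rewrite (coreN y z) // yc.
have pP w : ~~ h p w -> h u w /\ core (k w).
  move=> npw.
  have uw : h u w by have := hcot u w p up; rewrite [h w p]hsym (negPf npw) orbF.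
  have wq : h w q by have := hcot p w q pq; rewrite (negPf npw).
  have := coreN _ _ up uq pq; have := coreN _ _ uw uq wq; rewrite pc => -> /negbFE.
  by split.
have : #|[set w | ~~ h p w]| <= r.-1.
  apply: (@leq_card_in_nat _ _ (fun w => (part_index (k w)).-1)).
    move=> v w; rewrite !inE => /pP[uv vc] /pP[uw wc] vw; apply: kI; rewrite ?inE //.
    have := ks _ uv; have := ks _ uw; move: vc wc vw.
    case: (k v) => [[]|] i //= _; case: (k w) => [[]|] j //= _.
    move=> ij /negbT + /negbT; rewrite -!lt0n => j0 i0; congr (inl (inl _)); apply: val_inj => /=.
    by rewrite -(prednK i0) ij prednK.
  move=> w; rewrite inE => /pP[uw wc]; have := ks _ uw; move: wc.
  case: (k w) => [[]|] i //= _ /negbT; rewrite -lt0n => i0.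
  by rewrite -ltnS !prednK.
move=> /(leq_trans (card_part_ge p rs st)).
by rewrite leqNgt ltn_predL r0.
Qed.

(** The smallest sets allowed by [low_degree_split]: [#|A| = 1] and [#|B| = t - s + 1]. *)
Definition near_apex (s t : nat) (u : 'I_1 + 'I_s + 'I_t) : bool :=
  match u with
  | inl (inl _) => true
  | inl (inr j) => j == 0 :> nat
  | inr k => k < t - s + 1
  end.

Lemma near_apex_degree (s t : nat) (u : 'I_1 + 'I_s + 'I_t) :
  1 < s -> s <= t -> t < 2 * s - 2 ->
  #|[set w | complete_tripartite 1 s t u w & near_apex w == near_apex u]| < s.
Proof.
move=> s2 st ts.
suff : #|[set w | complete_tripartite 1 s t u w & near_apex w == near_apex u]| <= s.-1.
  by rewrite -ltnS prednK // ltnW.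
(* Numbers the own-side neighbors of [u] below [s - 1]; the values at other vertices are
   arbitrary. *)
pose idx (w : 'I_1 + 'I_s + 'I_t) : nat := match u, w with
  | inr k, inl (inr j) => if k < t - s + 1 then 1 else j.-1
  | inr k, _ => 0
  | inl (inr j), inr k => if j == 0 :> nat then k : nat else k - (t - s + 1)
  | inl (inl _), inr k => k
  | inl _, _ => t - s + 1
  end.
apply: (@leq_card_in_nat _ _ idx) => [v w|w]; rewrite !inE !complete_tripartiteE {}/idx.
  case: u => [[]|] i; case: v => [[]|] j; case: w => [[]|] k //=;
    try case: (nat_of_ord i == 0); try case: (nat_of_ord i < t - s + 1);
    move=> /eqP hv /eqP hw ij;
    first [ by exfalso; lia
          | by rewrite (ord1 j) (ord1 k)
          | by congr (inl (inr _)); apply: val_inj => /=; lia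
          | by congr (inr _); apply: val_inj => /=; lia ].
case: u => [[]|] i; case: w => [[]|] k //=; have := ltn_ord i; have := ltn_ord k;
  try case: (nat_of_ord i == 0); try case: (nat_of_ord i < t - s + 1); lia.
Qed.

(** Copies inherit own-side degrees below [s], so [low_degree_split] applies to them. As [A] and [B]
    are then nonempty and proper, every vertex has a neighbor on its own side. *)
Lemma not_admissible_r1 (R : realType) (s t : nat) (g : R) :
  1 < s -> s <= t -> t < 2 * s - 2 -> (0 <= g)%R -> (g < 1 / 2)%R ->
  ~ VC_admissible (complete_tripartite 1 s t) g.
Proof.
move=> s2 st ts g0 g2.
have s0 : 0 < s by lia.
have t0 : t.-1 < t by lia.
pose side := @near_apex s t.
pose x0 := apex s t.
pose x1 := second t (Ordinal s0).
pose y0 := third s (Ordinal t0).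
pose h := complete_tripartite 1 s t.
have hsym : symmetric h := @complete_tripartite_sym 1 s t.
have hcot : forall u v w, h u w -> h u v || h v w := @complete_tripartite_cotrans 1 s t.
have sy0 : ~~ side y0 by rewrite /= -leqNgt; lia.
apply: (@not_admissible_split R _ h side x0 y0 x1 y0) => //; try by rewrite /h complete_tripartiteE.
  exact: complete_tripartite_irr.
move=> d N f fI fh u.
have [|A [B [AE BE A0 B0 [AB tB]]]] := @low_degree_split s t (fun u => (f u).1) st.
  move=> v; have [x fx] := split_graph_own_degree v fI fh.
  exact: leq_ltn_trans fx (near_apex_degree x s2 st ts).
have [a aA] : exists a, a \in A by apply/card_gt0P.
have [b bB] : exists b, b \in B by apply/card_gt0P.
have [a' a'A] : exists a, a \notin A.
  have : #|~: A| > 0 by rewrite cardsCs setCK card_ord; lia.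
  by case/card_gt0P => j; rewrite inE; exists j.
have [b' b'B] : exists b, b \notin B.
  have : #|~: B| > 0 by rewrite cardsCs setCK card_ord; lia.
  by case/card_gt0P => j; rewrite inE; exists j.
case: u => [[i|j]|k].
- exists (second t a); first by rewrite /h complete_tripartiteE.
  by move: aA; rewrite AE (ord1 i) => /eqP.
- case: (boolP (j \in A)) => [|jA].
    by rewrite AE => /eqP jA; exists (apex s t); rewrite // /h complete_tripartiteE.
  exists (third s b'); first by rewrite /h complete_tripartiteE.
  by move: b'B jA; rewrite AE BE /second; do 3!case: (f _).1.
- case: (boolP (k \in B)) => [|kB].
    by rewrite BE => /eqP kB; exists (apex s t); rewrite // /h complete_tripartiteE.
  exists (second t a'); first by rewrite /h complete_tripartiteE.
  by move: a'A kB; rewrite AE BE /third; do 3!case: (f _).1.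
Qed.

(** * The threshold *)

Lemma VC_threshold_eq (R : realType) (U : finType) (h : rel U) (c : R) :
  (0 <= c)%R -> (forall g : R, (c < g)%R -> VC_admissible h g) ->
  (forall g : R, (0 <= g)%R -> (g < c)%R -> ~ VC_admissible h g) ->
  VC_threshold R h = c.
Proof.
move=> c0 above below; rewrite /VC_threshold.
have lbc : lbound [set g : R | (0 <= g)%R /\ VC_admissible h g]%classic c.
  by move=> g [g0 adm]; rewrite leNgt; apply/negP => /(below _ g0).
have c1 : (c < c + 1)%R by rewrite ltrDl.
apply/eqP; rewrite eq_le; apply/andP; split; last first.
  apply: lb_le_inf lbc; exists (c + 1)%R; split; last exact: above.
  exact: le_trans c0 (ltW c1).
apply/ler_addgt0Pr => eps eps0; apply: ge_inf; first by exists c.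
by split; [lra | apply: above; rewrite ltrDl].
Qed.

Lemma admissible_gt (R : realType) (U : finType) (h : rel U) (p q : nat) (g : R) :
  0 < q -> (p%:R / q%:R < g)%R ->
  (forall K, 0 < K -> exists C, forall (T : finType) (e : rel T),
     symmetric e -> irreflexive e -> maximal_free h e ->
     (forall v, (p * K + 1) * #|T| <= q * K * degree e v) -> VC_dim e <= C) ->
  VC_admissible h g.
Proof.
move=> q0 pg H; have [K K0 KP] := gt_ratio q0 pg; have [C CP] := H K K0.
exists C => T e [sym irr] maxe De; apply: CP => // v.
by apply: leq_trans (KP _ _ De) _; rewrite leq_mul2l min_degree_le orbT.
Qed.

Local Open Scope ring_scope.

Theorem theorem1p4 (R : realType) (r s t : nat)
    (hr : (1 <= r)%N) (hrs : (r <= s)%N) (hst : (s <= t)%N) :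
  VC_threshold R (complete_tripartite r s t) =
    if (r == 1%N) && (s == 1%N) then 1 / 3
    else if [&& r == 1%N, (2 <= s)%N & (2 * s - 2 <= t)%N]
    then s%:R / (2 * s%:R + 1)
    else 1 / 2.
Proof.
have s0 : (0 < s)%N by lia.
have natE : 2 * s%:R + 1 = (2 * s + 1)%N%:R :> R by rewrite natrD natrM.
case: ifP => [/andP[/eqP r1 /eqP s1]|c1].
  subst r s; apply: VC_threshold_eq.
  - by lra.
  - move=> g g3; apply: (@admissible_gt _ _ _ 1%N 3%N) => // K K0; rewrite mul1n.
    exact: VC_bounded_K11t.
  (* At [s = 1] the star ratio [s / (2 * s + 1)] is [1 / 3]. *)
  - by move=> g g0 g3; apply: not_admissible_star.
case: ifP => [/and3P[/eqP r1 s2 s2t]|c2].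
  subst r; rewrite natE; apply: VC_threshold_eq.
  - by rewrite divr_ge0.
  - move=> g gs; apply: (@admissible_gt _ _ _ s (2 * s + 1)%N) => // [|K K0]; first by rewrite addn1.
    exact: VC_bounded_K1st.
  - by move=> g g0 gs; apply: not_admissible_star.
apply: VC_threshold_eq.
- by lra.
- move=> g g2; apply: (@admissible_gt _ _ _ 1%N 2%N) => // K K0; rewrite mul1n.
  have [N0 N0P] := dense_contains_tripartite t K0 s0 hrs.
  (* Above one half a free graph has fewer than [N0] vertices, which bounds its VC-dimension. *)
  exists N0 => T e sym irr [free _] deg; apply: leq_trans (VC_dim_le_card e) _.
  by rewrite leqNgt; apply/negP => big; apply: free; apply: N0P (ltnW big).
- move=> g g0 g2; case: (ltnP 1%N r) => r1; first exact: not_admissible_r2.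
  have {r1} r1 : r = 1%N by lia.
  by subst r; apply: not_admissible_r1 => //; lia.
Qed.
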